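(* Let $0<i_1<\dots<i_m=n$ and let $\widetilde Y=\mathrm{Sp}(i_1,\dots,i_m)$. The map $S\mapsto \mathrm{pr}(Y_{\varphi(S)})$ is a bijection from the set of standard tableaux of type $(i_1,\dots,i_m)$ and shape $(n-k,k)$ onto the set of irreducible components of $\widetilde Y$.
   Context: Fix integers $n\ge 2k\ge 0$; $V$ is an $n$-dimensional complex vector space with basis $e_1,\dots,e_{n-k},f_1,\dots,f_k$ and $N$ is the nilpotent endomorphism $Ne_i=e_{i-1}$, $Nf_i=f_{i-1}$, $e_0=f_0=0$. $N^{-d}(U)$ denotes the preimage of a subspace $U$ under $N^d$. A partial flag of type $(i_1,\dots,i_m)$ ($0<i_1<\dots<i_m=n$) is a chain $F_{i_1}\subset\dots\subset F_{i_m}$ with $\dim F_{i_l}=i_l$; it is $N$-invariant if $NF_{i_l}\subset F_{i_{l-1}}$ for all $l$ ($F_{i_0}=\{0\}$). The Spaltenstein variety $\mathrm{Sp}(i_1,\dots,i_m)$ is the variety of $N$-invariant partial flags of type $(i_1,\dots,i_m)$; $\mathrm{Sp}(1,2,\dots,n)=Y$ is the Springer fibre. The map $\mathrm{pr}:Y\to\{\text{partial flags of type }(i_1,\dots,i_m)\}$ forgets the $F_j$ with $j\notin\{i_1,\dots,i_m\}$. Tableaux: a tableau of type $(i_1,\dots,i_m)$ (shape $(n-k,k)$) is a two-row Young diagram, top row of $n-k$ boxes, bottom row of $k$ boxes, filled so that $i_l$ occurs exactly $i_l-i_{l-1}$ times ($i_0=0$). It is row strict if entries strictly decrease from left to right along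 each row, and standard if moreover in each column the top entry is $\ge$ the bottom entry. An entry $i_l$ with $i_l-i_{l-1}=2$ (occurring once in each row) is a double entry. For a standard tableau $S$ of type $(i_1,\dots,i_m)$, $\varphi(S)$ is the standard tableau of type $(1,\dots,n)$ obtained by replacing, for each double entry $i_l$, its copy in the bottom row by $i_l-1$. Springer components: for a standard tableau $\sigma$ of type $(1,\dots,n)$, $Y_\sigma$ is the irreducible component of $Y$ attached to $\sigma$ by the Spaltenstein–Vargas bijection; explicitly (Fung), with the conventions $F_0=\{0\}=\operatorname{im}N^{n-k}$ and $0$ regarded as lying in the top row, $Y_\sigma$ is the set of full flags $F_1\subset\dots\subset F_n$ such that: (i) $F_i\subset N^{-1}(F_{i-1})$ for all $i$; (ii) if $i$ is in the top row of $\sigma$ and $i-1$ in the bottom row, then $F_i=N^{-1}(F_{i-2})$; (iii) if $i$ and $i-1$ are both in the top row, then: if $F_{i-1}=N^{-d}(F_r)$ with $r$ in the bottom row, then $F_i=N^{-d-1}(F_{r-1})$; if $F_{i-1}=N^{-d}(\operatorname{im}N^{n-k-j})$ with $0\le j<n-2k$, then $F_i=N^{-d}(\operatorname{im}N^{n-k-j-1})$ (these equalities $F_{i-1}=\dots$ refer to relations forced by the preceding conditions). *)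

(* Defs.v *)
From mathcomp Require Import all_boot all_algebra.
From mathcomp Require Import complex Rstruct.

Set Implicit Arguments.
Unset Strict Implicit.
Unset Printing Implicit Defensive.

Import GRing.Theory.

Definition C : closedFieldType := (Rdefinitions.R)[i].

(* Linear algebra conventions.  V = C^n is the space of row vectors
   'rV[C]_n; a subspace is the row space of a square matrix, always kept in
   the canonical form <<A>>%MS (so that equal subspaces are equal matrices).
   Basis: e_1..e_(n-k) have indices 0..n-k-1, f_1..f_k have indices
   n-k..n-1.  Linear maps act on the right: v |-> v *m A, and for a subspace
   U (given by its matrix), U *m A is (a matrix whose row space is) N(U).   *)

(* The nilpotent N : e_i |-> e_(i-1), f_i |-> f_(i-1), e_0 = f_0 = 0.
   Row (index) i is sent to row i-1 except for i = 0 (e_1) and i = n-k (f_1). *)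
Definition Nmx (n k : nat) : 'M[C]_n :=
  \matrix_(i < n, j < n) ((i == j.+1 :> nat) && (i != (n - k)%N :> nat))%:R%R.

Definition is_flag (n : nat) (t : seq nat) (F : seq 'M[C]_n) : Prop :=
  size F = size t /\
  (forall l, l < size t ->
     <<nth 0%R F l>>%MS = nth 0%R F l /\ \rank (nth 0%R F l) = nth 0%N t l) /\
  (forall l, l.+1 < size t -> (nth 0%R F l <= nth 0%R F l.+1)%MS).

Definition flag_prev (n : nat) (F : seq 'M[C]_n) (l : nat) : 'M[C]_n :=
  if l is l'.+1 then nth 0%R F l' else 0%R.

Definition N_invariant (n k : nat) (t : seq nat) (F : seq 'M[C]_n) : Prop :=
  forall l, l < size t -> ((nth 0%R F l *m Nmx n k)%R <= flag_prev F l)%MS.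

Definition Sp (n k : nat) (t : seq nat) (F : seq 'M[C]_n) : Prop :=
  is_flag t F /\ N_invariant k t F.

Definition full_type (n : nat) : seq nat := iota 1 n.

Definition Springer (n k : nat) : seq 'M[C]_n -> Prop := Sp k (full_type n).

(* pr : forget the F_j with j not in t (F_j is the (j-1)-th entry). *)
Definition pr (n : nat) (t : seq nat) (F : seq 'M[C]_n) : seq 'M[C]_n :=
  map (fun d => nth 0%R F d.-1) t.

(* Zariski topology on the variety of partial flags of type t, as the
   quotient topology of GL_n -> GL_n / P: the flag attached to an invertible
   g has F_(i_l) = span of the first i_l rows of g.  A set of flags of type t
   is closed iff its preimage in GL_n is the trace on GL_n of the common zero
   set of a family of polynomial functions in the n^2 matrix entries.      *)

Inductive polyfun (n : nat) : ('M[C]_n -> C) -> Prop :=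
| pf_cst (c : C) : polyfun (fun _ => c)
| pf_coord (i j : 'I_n) : polyfun (fun g => g i j)
| pf_add p q : polyfun p -> polyfun q -> polyfun (fun g => (p g + q g)%R)
| pf_mul p q : polyfun p -> polyfun q -> polyfun (fun g => (p g * q g)%R).

Definition flag_of (n : nat) (t : seq nat) (g : 'M[C]_n) : seq 'M[C]_n :=
  map (fun d => <<((pid_mx d : 'M[C]_n) *m g)%R>>%MS) t.

Definition zclosed (n : nat) (t : seq nat) (A : seq 'M[C]_n -> Prop) : Prop :=
  (forall F, A F -> is_flag t F) /\
  exists S : ('M[C]_n -> C) -> Prop,
    (forall p, S p -> polyfun p) /\
    (forall g : 'M[C]_n, g \in unitmx ->
       (A (flag_of t g) <-> (forall p, S p -> p g = 0%R))).

Definition subset_of (T : Type) (A B : T -> Prop) : Prop := forall x, A x -> B x.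
Definition seteq (T : Type) (A B : T -> Prop) : Prop := forall x, A x <-> B x.

Definition zclosure (n : nat) (t : seq nat) (A : seq 'M[C]_n -> Prop)
  : seq 'M[C]_n -> Prop :=
  fun F => is_flag t F /\
    forall Z, zclosed t Z -> subset_of A Z -> Z F.

Definition irreducible (n : nat) (t : seq nat) (A : seq 'M[C]_n -> Prop) : Prop :=
  (exists F, A F) /\ subset_of A (is_flag t) /\
  forall C1 C2, zclosed t C1 -> zclosed t C2 ->
    subset_of A (fun F => C1 F \/ C2 F) ->
    subset_of A C1 \/ subset_of A C2.

Definition irr_component (n : nat) (t : seq nat) (X Z : seq 'M[C]_n -> Prop)
  : Prop :=
  irreducible t Z /\ subset_of Z X /\
  forall Z', irreducible t Z' -> subset_of Z Z' -> subset_of Z' X ->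
    subset_of Z' Z.

(* Tableaux of shape (n-k, k): a pair (top row, bottom row), read left to
   right.                                                                  *)

Definition tableau := (seq nat * seq nat)%type.

Definition tmult (t : seq nat) (v : nat) : nat :=
  if v \in t then v - last 0 [seq u <- t | u < v] else 0.

Definition is_type (t : seq nat) (S : tableau) : Prop :=
  forall v, count_mem v (S.1 ++ S.2) = tmult t v.

Definition row_strict (S : tableau) : Prop :=
  sorted (fun x y : nat => y < x) S.1 /\ sorted (fun x y : nat => y < x) S.2.

Definition standard_tableau (n k : nat) (t : seq nat) (S : tableau) : Prop :=
  size S.1 = n - k /\ size S.2 = k /\ is_type t S /\ row_strict S /\
  (forall c, c < k -> nth 0%N S.2 c <= nth 0%N S.1 c).

Definition double_entry (t : seq nat) (v : nat) : bool := tmult t v == 2.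

Definition phi (t : seq nat) (S : tableau) : tableau :=
  (S.1, map (fun x => if double_entry t x then x.-1 else x) S.2).

(* Springer components (Spaltenstein-Vargas).  For a standard tableau sigma
   of type (1,...,n), Y_sigma is the closure of the set of full flags F in Y
   such that, for every i, the Jordan type of N on V/F_i is the shape of the
   part of sigma consisting of the entries > i (a two-row shape (a,b)).
   The Jordan type (a,b), a >= b, is encoded through the ranks of the powers
   of the induced map: rank(N^j on V/F_i) = (a-j)_+ + (b-j)_+ for all j,
   i.e. dim(N^j(V) + F_i) = i + (a-j)_+ + (b-j)_+.                          *)

Definition full_flag_at (n : nat) (F : seq 'M[C]_n) (i : nat) : 'M[C]_n :=
  if i is i'.+1 then nth 0%R F i' else 0%R.

Definition springer_cell (n k : nat) (sigma : tableau) (F : seq 'M[C]_n) : Prop :=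
  Springer k F /\
  forall i, i <= n ->
    let a := count (fun x => i < x) sigma.1 in
    let b := count (fun x => i < x) sigma.2 in
    forall j, \rank ((Nmx n k ^+ j)%R + full_flag_at F i)%MS = (i + ((a - j) + (b - j)))%N.

Definition springer_component (n k : nat) (sigma : tableau) : seq 'M[C]_n -> Prop :=
  zclosure (full_type n) (springer_cell k sigma).

Definition pr_image (n k : nat) (t : seq nat) (sigma : tableau)
  : seq 'M[C]_n -> Prop :=
  fun P => exists F, springer_component k sigma F /\ P = pr t F.

Definition valid_type (n : nat) (t : seq nat) : Prop :=
  t <> [::] /\ sorted ltn (0%N :: t) /\ last 0 t = n.

(* Main.v *)
(* Write N for the nilpotent map.  The pair (V/U, N) of Jordan type (a, b) is
   handled through a frame (e, y): modulo U, V is the sum of the cyclic modules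
   generated by e and y, with annihilators X^a and X^b.  The flags of Sp(t)
   are cut into cells by prescribing the Jordan type (a_l, b_l) of each V/F_l;
   a step of the flag removes a box from the top row (one choice of subspace),
   from the bottom row (an affine or projective line of choices), or one from
   each (one choice), so cells correspond to standard tableaux.
   - Cells are irreducible: two points agreeing up to step l are joined by
     moving with matrices that fix F_l pointwise and commute with N modulo F_l;
     these form an open subset of an affine space, and composing the moves joins
     any two points of a cell by one polynomial curve of matrices.
   - No cell lies in the closure of another: if l is a top step of the second
     cell, then on its closure F_l lies in the preimage under a power of N of an
     earlier F_m (matched top) or of some im N^c (unmatched top), of dimension
     at most dim F_l; so earlier subspaces determine F_l, which fails at a
     bottom step.
   - The refinements of a flag in the cell of S form a product of projective
     lines in which the cell of phi(S) is dense, and the flags all of whose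
     refinements lie in a closed set form a closed set; hence pr maps the
     closure of the cell of phi(S) onto the closure of the cell of S. *)
Require Import Defs.
From mathcomp Require Import all_boot all_algebra.
From mathcomp Require Import complex Rstruct.
From mathcomp Require Import zify ring.
From Stdlib Require Import Classical.

Set Implicit Arguments.
Unset Strict Implicit.
Unset Printing Implicit Defensive.

Import GRing.Theory.
Local Open Scope ring_scope.

(** * Frames of a nilpotent map *)

Ltac zmod_row := by apply/rowP => ?; rewrite !mxE; ring.

Section Frames.
Variables (K : fieldType) (n' : nat).
Local Notation n := n'.+1.
Variable N : 'M[K]_n.
Implicit Types (U W : 'M[K]_n) (e y v x : 'rV[K]_n) (p q : {poly K}).

(** The $K[X]$-module structure in which $X$ acts as [N]; Jordan types become statements about
    divisibility by powers of $X$. *)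
Definition act v p : 'rV[K]_n := v *m horner_mx N p.

Lemma actD v p q : act v (p + q) = act v p + act v q.
Proof. by rewrite /act rmorphD mulmxDr. Qed.

Lemma actB v p q : act v (p - q) = act v p - act v q.
Proof. by rewrite /act rmorphB mulmxBr. Qed.

Lemma actM v p q : act v (p * q) = act (act v p) q.
Proof. by rewrite /act rmorphM mulmxA. Qed.

Lemma actXn v i : act v 'X^i = v *m N ^+ i.
Proof. by rewrite /act rmorphXn /= horner_mx_X. Qed.

Lemma actX v : act v 'X = v *m N.
Proof. by rewrite /act horner_mx_X. Qed.

Lemma actC v c : act v c%:P = c *: v.
Proof. by rewrite /act horner_mx_C mul_mx_scalar. Qed.

Lemma actZ v c p : act v (c *: p) = c *: act v p.
Proof. by rewrite -mul_polyC mulrC actM actC. Qed.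

Lemma actDl v x p : act (v + x) p = act v p + act x p.
Proof. by rewrite /act mulmxDl. Qed.

Lemma actBl v x p : act (v - x) p = act v p - act x p.
Proof. by rewrite /act mulmxBl. Qed.

Lemma actZl c v p : act (c *: v) p = c *: act v p.
Proof. by rewrite /act scalemxAl. Qed.

Lemma powS i : N ^+ i.+1 = N *m N ^+ i.
Proof. exact: exprS. Qed.

Lemma powSr i : N ^+ i.+1 = N ^+ i *m N.
Proof. exact: exprSr. Qed.

Lemma powD i j : N ^+ (i + j) = N ^+ i *m N ^+ j.
Proof. exact: exprD. Qed.

Lemma stable_expr m (U : 'M[K]_(m, n)) i :
  (U *m N <= U)%MS -> (U *m N ^+ i <= U)%MS.
Proof.
move=> sU; elim: i => [|i IH]; first by rewrite expr0 mulmx1.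
by rewrite powSr mulmxA; apply: submx_trans sU; apply: submxMr.
Qed.

Lemma stable_act U v p : (U *m N <= U)%MS -> (v <= U)%MS -> (act v p <= U)%MS.
Proof.
move=> sU vU; elim/poly_ind: p => [|p c IH].
  by rewrite /act rmorph0 mulmx0 sub0mx.
rewrite actD actM actC actX addmx_sub ?scalemx_sub //.
by apply: submx_trans sU; apply: submxMr.
Qed.

(** The last two clauses say that [e] and [y] generate $V/U$ and that the only relations are
    multiples of $X^a$ and $X^b$. No order of [a] and [b] is imposed, so the two chains may be
    exchanged. *)
Definition frame U a b e y :=
  [/\ (U *m N <= U)%MS, (e *m N ^+ a <= U)%MS, (y *m N ^+ b <= U)%MS,
   (forall v, exists p q, (v - act e p - act y q <= U)%MS)
   & forall p q, ((act e p + act y q)%R <= U)%MS -> ('X^a %| p) && ('X^b %| q)].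

Lemma frame_eqmx U W a b e y : (U :=: W)%MS -> frame U a b e y -> frame W a b e y.
Proof.
move=> eUW [s1 s2 s3 s4 s5]; split; rewrite -?eUW //.
- by rewrite -(eqmxMr N eUW).
- by move=> v; have [p [q]] := s4 v; exists p, q; rewrite -eUW.
- by move=> p q; rewrite -eUW; apply: s5.
Qed.

Lemma frame_sym U a b e y : frame U a b e y -> frame U b a y e.
Proof.
move=> [s1 s2 s3 s4 s5]; split=> //.
  by move=> v; have [p [q]] := s4 v; exists q, p; rewrite addrAC.
by move=> p q; rewrite addrC andbC; apply: s5.
Qed.

(** A relation modulo the larger subspace becomes one modulo [U] after subtracting a multiple of
    $X^a$ from [p]; since $X^{a+1}$ divides the difference, $X^a$ still divides [p]. *)
Lemma frame_drop U a b e y : frame U a.+1 b e y ->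
  frame (U + e *m N ^+ a)%MS a b e y.
Proof.
move=> [s1 s2 s3 s4 s5]; split.
- rewrite addsmxMr addsmx_sub (submx_trans s1) ?addsmxSl //=.
  by rewrite -mulmxA -powSr (submx_trans s2) ?addsmxSl.
- exact: addsmxSr.
- exact: submx_trans (addsmxSl _ _).
- move=> v; have [p [q s]] := s4 v; exists p, q.
  exact: submx_trans (addsmxSl _ _).
- move=> p q /sub_addsmxP [[u1 u2]] /= eq1.
  set c := u2 0 0.
  have eu2 : u2 *m (e *m N ^+ a) = act e (c *: 'X^a).
    by rewrite actZ actXn [u2]mx11_scalar mul_scalar_mx.
  have /s5/andP[d1 d2] : ((act e (p - c *: 'X^a) + act y q)%R <= U)%MS.
    by rewrite actB addrAC eq1 eu2 addrK submxMl.
  have dc : 'X^a %| c *: 'X^a by rewrite -mul_polyC dvdp_mulIr.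
  rewrite d2 andbT -(subrK (c *: 'X^a) p) dvdp_addl //.
  by apply: dvdp_trans d1; rewrite exprS dvdp_mulIr.
Qed.

Lemma frame_dropr U a b e y : frame U a b.+1 e y ->
  frame (U + y *m N ^+ b)%MS a b e y.
Proof. by move=> /frame_sym/frame_drop/frame_sym. Qed.

(** The exponents [a - b] and [b] add up to [a], so $X^b$ still sends the new generator into [U].
    Relations undergo a triangular substitution whose correction to [p] is divisible by $X^a$ once
    $X^b$ divides [q]. *)
Lemma frame_change U a b e y c : (b <= a)%N -> frame U a b e y ->
  frame U a b e (y + c *: (e *m N ^+ (a - b))).
Proof.
move=> ba [s1 s2 s3 s4 s5].
set y' := y + _.
have yE q : act y' q = act y q + act e (c *: ('X^(a - b) * q)).
  by rewrite actDl actZl -actXn -actM actZ.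
split=> //.
- rewrite mulmxDl addmx_sub // -scalemxAl scalemx_sub //.
  by rewrite -mulmxA -powD subnK.
- move=> v; have [p [q s]] := s4 v.
  exists (p - c *: ('X^(a - b) * q)), q.
  rewrite yE actB; move: s; congr (_ <= _)%MS.
  zmod_row.
- move=> p q; rewrite yE addrCA addrC -actD => /s5 /andP[d1 d2].
  have dc : 'X^a %| c *: ('X^(a - b) * q).
    by rewrite -mul_polyC dvdp_mull // -{1}(subnK ba) exprD dvdp_mul.
  by rewrite d2 andbT; move: d1; rewrite dvdp_addl.
Qed.

(** In frame coordinates the hypothesis gives $X^a \mid pX$ and $X^b \mid qX$, so only the last
    vectors of the two chains survive modulo [U]. *)
Lemma frame_kernel U a b e y v : frame U a b e y -> (v *m N <= U)%MS ->
  exists c d, (v - c *: (e *m N ^+ a.-1) - d *: (y *m N ^+ b.-1) <= U)%MS.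
Proof.
move=> [s1 s2 s3 s4 s5] vN; have [p [q s]] := s4 v.
have /s5/andP[dp dq] : ((act e (p * 'X) + act y (q * 'X))%R <= U)%MS.
  have eqn : act e (p * 'X) + act y (q * 'X) =
     v *m N - (v - act e p - act y q) *m N.
    by rewrite !actM !actX !mulmxBl !opprD !opprK !addrA subrr add0r.
  by rewrite eqn addmx_sub // eqmx_opp (submx_trans _ s1) // submxMr.
have aux m (w : 'rV[K]_n) r : (w *m N ^+ m <= U)%MS -> 'X^m %| r * 'X ->
   exists c, (act w r - c *: (w *m N ^+ m.-1) <= U)%MS.
  case: m => [|m] wU.
    (* The generator of an empty chain lies in [U], so the coefficient 0 serves. *)
    by exists 0; rewrite scale0r subr0 stable_act //; rewrite expr0 mulmx1 in wU.
  rewrite exprSr dvdp_mul2r ?polyX_eq0 // => /dvdpP[r' ->] /=.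
  exists r'.[0].
  have /dvdpP[r'' er] : 'X %| r' - r'.[0]%:P.
    by rewrite -['X]subr0 -[X in _ - X]polyC0 dvdp_XsubCl /root !hornerE subrr.
  rewrite -(subrK r'.[0]%:P r') er mulrDl actD mul_polyC actZ actXn.
  have -> : (r'' * 'X + r'.[0]%:P).[0] = r'.[0] by rewrite !hornerE.
  by rewrite addrK -mulrA -exprS mulrC actM actXn stable_act.
have [c sc] := aux _ _ _ s2 dp; have [d sd] := aux _ _ _ s3 dq.
exists c, d.
have -> : v - c *: (e *m N ^+ a.-1) - d *: (y *m N ^+ b.-1) =
   (v - act e p - act y q) + (act e p - c *: (e *m N ^+ a.-1))
     + (act y q - d *: (y *m N ^+ b.-1)).
  zmod_row.
by apply: addmx_sub sd; apply: addmx_sub s sc.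
Qed.

Definition krylov v m : 'M[K]_(m, n) := \matrix_(i < m) (v *m N ^+ i).

Lemma krylovE v m (c : 'rV[K]_m) : c *m krylov v m = act v (rVpoly c).
Proof.
rewrite mulmx_sum_row /rVpoly poly_def.
transitivity (\sum_(i < m) act v (c 0 i *: 'X^i)).
  by apply: eq_bigr => i _; rewrite rowK actZ actXn.
rewrite /act -mulmx_sumr -rmorph_sum; congr (_ *m horner_mx N _).
by apply: eq_bigr => i _; rewrite insubT // => lti; congr (c _ _ *: _); apply: val_inj.
Qed.

(** Coefficient rows of the Krylov blocks are polynomials of degree below [a] and [b]. Only zero
    among them is divisible by $X^a$ or $X^b$, which gives freeness; division with remainder by
    these powers gives fullness. *)
Lemma frame_basis U a b e y : frame U a b e y ->
  let B := col_mx (row_base U) (col_mx (krylov e a) (krylov y b)) in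
  row_free B /\ row_full B.
Proof.
move=> [s1 s2 s3 s4 s5] B; split.
- rewrite -kermx_eq0; apply/rowV0P => u /sub_kermxP.
  rewrite -[u]hsubmxK /B mul_row_col -[rsubmx u]hsubmxK mul_row_col !krylovE.
  set u0 := lsubmx u; set u1 := lsubmx _; set u2 := rsubmx _ => eq0.
  have /s5/andP[d1 d2] : ((act e (rVpoly u1) + act y (rVpoly u2))%R <= U)%MS.
    have -> : act e (rVpoly u1) + act y (rVpoly u2) = - (u0 *m row_base U).
      by apply/eqP; rewrite -addr_eq0 addrC eq0.
    by rewrite eqmx_opp (submx_trans (submxMl _ _)) // eq_row_base.
  have small m (w : 'rV[K]_m) : 'X^m %| rVpoly w -> w = 0.
    move=> dv; apply/eqP; rewrite -[w]rVpolyK.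
    have [->|nz] := eqVneq (rVpoly w) 0; first by rewrite linear0.
    have := dvdp_leq nz dv; rewrite size_polyXn ltnNge.
    by rewrite size_poly.
  move: eq0; rewrite (small _ _ d1) (small _ _ d2).
  rewrite !linear0 /act !(rmorph0 (horner_mx N)) !mulmx0 !addr0 => /eqP.
  rewrite mulmx_free_eq0 ?row_base_free // => /eqP ->.
  by rewrite !row_mx0.
- rewrite -sub1mx; apply/row_subP => i; move: (row i _) => v.
  have [p [q s]] := s4 v.
  have small m (w : 'rV[K]_n) r : (w *m N ^+ m <= U)%MS ->
     (act w r <= U + krylov w m)%MS.
    move=> wU; rewrite (divp_eq r 'X^m) actD mulrC actM actXn addmx_sub //.
      by rewrite (submx_trans _ (addsmxSl _ _)) // stable_act.
    have sz : (size (r %% 'X^m)%R <= m)%N.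
      by rewrite -ltnS -[X in (_ < X)%N](size_polyXn K) ltn_modp monic_neq0 ?monicXn.
    rewrite -(poly_rV_K sz) -krylovE (submx_trans (submxMl _ _)) //.
    exact: addsmxSr.
  have -> : v = (v - act e p - act y q) + act e p + act y q
    by zmod_row.
  have UB : (U <= B)%MS by rewrite -addsmxE -(eq_row_base U) addsmxSl.
  have eB : (krylov e a <= B)%MS.
    by rewrite -addsmxE (submx_trans _ (addsmxSr _ _)) // -addsmxE addsmxSl.
  have yB : (krylov y b <= B)%MS.
    by rewrite -addsmxE (submx_trans _ (addsmxSr _ _)) // -addsmxE addsmxSr.
  apply: addmx_sub; first apply: addmx_sub; first exact: submx_trans s UB.
    by apply: submx_trans (small _ _ p s2) _; rewrite addsmx_sub UB.
  by apply: submx_trans (small _ _ q s3) _; rewrite addsmx_sub UB.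
Qed.

Lemma frame_rank U a b e y : frame U a b e y -> (\rank U + (a + b))%N = n.
Proof.
by case/frame_basis => /eqP r1 /eqP r2; exact: etrans (esym r1) r2.
Qed.

(** Dividing further by the image of $N^j$ replaces $K[X]/X^a$ by $K[X]/(X^a, X^j)$, with the same
    generator. *)
Lemma frame_powers U a b e y j : frame U a b e y ->
  frame (N ^+ j + U)%MS (minn a j) (minn b j) e y.
Proof.
move=> [s1 s2 s3 s4 s5].
have pw m (w : 'rV[K]_n) : (w *m N ^+ m <= U)%MS ->
    (w *m N ^+ minn m j <= N ^+ j + U)%MS.
  move=> wU; case: (leqP m j) => _.
    exact: submx_trans (addsmxSr _ _).
  by rewrite (submx_trans (submxMl _ _)) ?addsmxSl.
split; try exact: pw.
- rewrite addsmxMr addsmx_sub (submx_trans s1) ?addsmxSr // andbT.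
  rewrite -powSr powS.
  exact: submx_trans (submxMl _ _) (addsmxSl _ _).
- move=> v; have [p [q s]] := s4 v; exists p, q.
  exact: submx_trans (addsmxSr _ _).
- move=> p q /sub_addsmxP [[u1 u2]] /= eq1.
  have [p' [q' s]] := s4 u1.
  have /s5/andP[d1 d2] : ((act e (p - p' * 'X^j) + act y (q - q' * 'X^j))%R <= U)%MS.
    have -> : act e (p - p' * 'X^j) + act y (q - q' * 'X^j) =
        act (u1 - act e p' - act y q') 'X^j + u2 *m U.
      rewrite !actB !actM !actBl -[LHS](addrK (act e p + act y q)) {1}eq1 -!actXn.
      zmod_row.
    by rewrite addmx_sub ?submxMl ?stable_act.
  have aux m (r s' : {poly K}) : 'X^m %| r - s' * 'X^j -> 'X^(minn m j) %| r.
    move=> dv; rewrite -(subrK (s' * 'X^j) r) dvdp_addl.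
      by apply: dvdp_trans dv; rewrite dvdp_exp2l ?geq_minl.
    by rewrite dvdp_mull // dvdp_exp2l ?geq_minr.
  by rewrite (aux _ _ _ d1) (aux _ _ _ d2).
Qed.

Lemma rank_powers U a b e y j : frame U a b e y ->
  \rank (N ^+ j + U)%MS = (\rank U + ((a - j) + (b - j)))%N.
Proof.
by move=> fr; have := frame_rank fr; have := frame_rank (frame_powers j fr); lia.
Qed.

Lemma frame_power_sub U a b e y c : frame U a b e y ->
  (N ^+ c <= U)%MS = (maxn a b <= c)%N.
Proof.
move=> fr; have rk := rank_powers c fr.
have -> : (N ^+ c <= U)%MS = (\rank (N ^+ c + U)%MS == \rank U).
  rewrite eq_sym (mxrank_leqif_sup (addsmxSr (N ^+ c) U)).
  by rewrite addsmx_sub submx_refl andbT.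
by rewrite rk; lia.
Qed.

(** The larger part is the nilpotency index of [N] on $V/U$, and the sum of the parts is the
    dimension of $V/U$. *)
Lemma frame_unique U a b e y a' b' e' y' : (b <= a)%N -> (b' <= a')%N ->
  frame U a b e y -> frame U a' b' e' y' -> a = a' /\ b = b'.
Proof.
move=> ba ba' fr fr'.
have := frame_power_sub a fr; have := frame_power_sub a fr'.
have := frame_power_sub a' fr; have := frame_power_sub a' fr'.
have := frame_rank fr; have := frame_rank fr'.
rewrite (maxn_idPl ba) (maxn_idPl ba') !leqnn => r1 r2 -> h1 -> h2.
by lia.
Qed.

Lemma addsmx_row_eq U W x : (U <= W)%MS -> \rank W = (\rank U).+1 ->
  (x <= W)%MS -> ~~ (x <= U)%MS -> (W :=: U + x)%MS.
Proof.
move=> UW rW xW xU; apply/eqmx_sym/eqmxP.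
have sW : (U + x <= W)%MS by rewrite addsmx_sub UW.
rewrite -(mxrank_leqif_eq sW) eqn_leq mxrankS //= rW.
have: (U < U + x)%MS.
  by rewrite /ltmx addsmxSl /= addsmx_sub submx_refl.
exact: rank_ltmx.
Qed.

Lemma addsmx_row_cong m (U : 'M[K]_(m, n)) x z c :
  c != 0 -> (x - c *: z <= U)%MS -> (U + x :=: U + z)%MS.
Proof.
move=> c0 xz; apply/eqmxP; rewrite !addsmx_sub !addsmxSl /=; apply/andP; split.
  by rewrite -(subrK (c *: z) x) addmx_sub_adds //; exact: scalemx_sub.
rewrite -(eqmx_scale _ c0).
have -> : c *: z = - (x - c *: z) + x by rewrite opprB subrK.
by rewrite addmx_sub_adds // eqmx_opp.
Qed.

(* A kernel line that is not the special one is the end of some chain. *)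
Lemma frame_generic_row U a b e y x c d : (b < a)%N -> frame U a b.+1 e y ->
  d != 0 -> (x - c *: (e *m N ^+ a.-1) - d *: (y *m N ^+ b) <= U)%MS ->
  exists y', frame U a b.+1 e y' /\ (U + x :=: U + y' *m N ^+ b)%MS.
Proof.
move=> ba fr d0 s; exists (y + (c / d) *: (e *m N ^+ (a - b.+1))).
split; first exact: frame_change.
apply: (addsmx_row_cong d0); rewrite mulmxDl -scalemxAl -mulmxA -powD.
have -> : (a - b.+1 + b = a.-1)%N by clear -ba; lia.
rewrite scalerDr scalerA mulrCA divff // mulr1.
by rewrite [d *: _ + _]addrC opprD addrA.
Qed.

(** $W/U$ lies in the kernel of [N] on $V/U$, which the ends of the two chains span, so it is a line
    or a plane. The frame is then adapted so that [W] adds chain ends only. *)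
Lemma step_frame U W a b e y : (b <= a)%N -> frame U a b e y ->
  (U <= W)%MS -> (W *m N <= U)%MS -> (\rank U < \rank W)%N ->
  exists e y, frame U a b e y /\
    [\/ (b < a)%N /\ (W :=: U + e *m N ^+ a.-1)%MS,
        (0 < b)%N /\ (W :=: U + y *m N ^+ b.-1)%MS
      | (0 < b)%N /\ (W :=: U + e *m N ^+ a.-1 + y *m N ^+ b.-1)%MS].
Proof.
move=> ba fr UW WN rk.
set e1 := e *m N ^+ a.-1; set y1 := y *m N ^+ b.-1.
have WK : (W <= U + e1 + y1)%MS.
  apply/row_subP => i; have xN : (row i W *m N <= U)%MS.
    by rewrite -row_mul (submx_trans (row_sub _ _)).
  have [c [d s]] := frame_kernel fr xN.
  have -> : row i W = (row i W - c *: e1 - d *: y1) + c *: e1 + d *: y1.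
    by zmod_row.
  apply: addmx_sub_adds; last exact: scalemx_sub.
  by apply: addmx_sub_adds => //; exact: scalemx_sub.
have r1 (v : 'rV[K]_n) : (\rank v <= 1)%N by exact: rank_leq_row.
have rK : (\rank (U + e1 + y1)%MS <= (\rank U).+2)%N.
  have := mxrank_adds_leqif (U + e1)%MS y1.
  have := mxrank_adds_leqif U e1.
  by have := r1 e1; have := r1 y1; move=> ? ? [? _] [? _]; lia.
have b0y1 : b = 0%N -> (y1 <= U)%MS.
  by case: fr => _ _ + _ _ b0; rewrite /y1 b0 /=.
have [gap|gap] : \rank W = (\rank U).+1 \/ \rank W = (\rank U).+2.
  by have := mxrankS WK; lia.
- have /row_subPn[i xU] : ~~ (W <= U)%MS.
    by apply/negP => /mxrankS; lia.
  set x := row i W in xU.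
  have xW : (x <= W)%MS by exact: row_sub.
  have xN : (x *m N <= U)%MS by rewrite /x -row_mul (submx_trans (row_sub _ _)).
  have [c [d s]] := frame_kernel fr xN.
  rewrite -/e1 -/y1 in s.
  have sW v : (x - v <= U)%MS -> ~~ (v <= U)%MS /\ (v <= W)%MS.
    move=> xv; split.
      by apply: contra xU => vU; rewrite -(subrK v x) addmx_sub.
    have -> : v = x - (x - v) by zmod_row.
    by rewrite addmx_sub // eqmx_opp (submx_trans xv).
  have [bd0|] := boolP ((b == 0%N) || (d == 0)).
    have xe : (x - c *: e1 <= U)%MS.
      rewrite -(subrK (d *: y1) (x - _)) addmx_sub //.
      case/orP: bd0 => /eqP h; first by rewrite scalemx_sub ?b0y1.
      by rewrite h scale0r sub0mx.
    have [ceU ceW] := sW _ xe.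
    have c0 : c != 0 by apply: contraNneq ceU => ->; rewrite scale0r sub0mx.
    rewrite !(eqmx_scale _ c0) in ceU ceW.
    have eqW := addsmx_row_eq UW gap ceW ceU.
    case: (ltnP b a) => [lt|ge]; first by exists e, y; split=> //; constructor 1.
    (* With equal parts the end of the [e]-chain counts as a bottom step: the two generators are
       exchanged, so that the shape remaining after the step keeps its smaller part second. *)
    have eab : a = b by apply/eqP; rewrite eqn_leq ge ba.
    have b0 : (0 < b)%N.
      rewrite lt0n; apply: contraNneq ceU => b0; case: (fr) => _ + _ _ _.
      by rewrite /e1 eab b0.
    exists y, e; split; first by move/frame_sym: fr; rewrite eab.
    by constructor 2; split=> //; rewrite -eab.
  rewrite negb_or -lt0n => /andP[b0 d0].
  have eb : b = b.-1.+1 by rewrite prednK.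
  have [y' [fr' eqU]] : exists y', frame U a b e y' /\ (U + x :=: U + y' *m N ^+ b.-1)%MS.
    by rewrite [in frame _ _ b]eb; apply: (frame_generic_row (c := c) _ _ d0 s); rewrite -eb.
  exists e, y'; split=> //; constructor 2; split=> //.
  exact: eqmx_trans (addsmx_row_eq UW gap xW xU) eqU.
- exists e, y; split=> //; constructor 3; split.
    rewrite lt0n; apply/eqP => /b0y1 yU.
    have : (W <= U + e1)%MS.
      by apply: submx_trans WK _; rewrite addsmx_sub submx_refl (submx_trans yU) ?addsmxSl.
    move/mxrankS; have := mxrank_adds_leqif U e1; have := r1 e1.
    by move=> ? [? _]; lia.
  by apply/eqmxP; rewrite -(mxrank_leqif_eq WK) eqn_leq mxrankS //= gap.
Qed.

(** [w] maps the basis of one frame to that of the other. Commutation with [N] modulo [U] is checked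
    on basis vectors: each chain is shifted, and its last vector is sent into [U], where [w] is the
    identity. *)
Lemma frame_transport U a b e y e' y' : frame U a b e y -> frame U a b e' y' ->
  exists w : 'M[K]_n, [/\ w \in unitmx, U *m w = U, (w *m N - N *m w <= U)%MS,
    (forall i, (i < a)%N -> e *m N ^+ i *m w = e' *m N ^+ i)
  & (forall i, (i < b)%N -> y *m N ^+ i *m w = y' *m N ^+ i)].
Proof.
move=> fr fr'.
have [Bfree Bfull] := frame_basis fr; have [_ Bfull'] := frame_basis fr'.
set B := col_mx _ _ in Bfree Bfull; set B' := col_mx _ _ in Bfull'.
have [w Bw] : exists w, B *m w = B'.
  by exists (pinvmx B *m B'); rewrite mulmxA mulmxVp // mul1mx.
move: (Bw); rewrite /B /B' !mul_col_mx => /eq_col_mx[Uw /eq_col_mx[ew yw]].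
have fixU m (v : 'M_(m, n)) : (v <= U)%MS -> v *m w = v.
  by rewrite -(eq_row_base U) => /submxP[D ->]; rewrite -mulmxA Uw.
have ek m (v v' : 'rV[K]_n) i : krylov v m *m w = krylov v' m -> (i < m)%N ->
    v *m N ^+ i *m w = v' *m N ^+ i.
  move=> eq lt; move/(congr1 (row (Ordinal lt))): eq.
  by rewrite row_mul !rowK.
exists w; split; try by move=> i; exact: ek.
- rewrite -row_full_unit -sub1mx; apply: submx_trans (submxMl B w).
  by rewrite Bw sub1mx.
- exact: fixU.
- have [s1 s2 s3 _ _] := fr; have [_ s2' s3' _ _] := fr'.
  have kr m (v v' : 'rV[K]_n) : krylov v m *m w = krylov v' m ->
      (v *m N ^+ m <= U)%MS -> (v' *m N ^+ m <= U)%MS ->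
      (krylov v m *m (w *m N - N *m w) <= U)%MS.
    move=> kw vU v'U; apply/row_subP => i; rewrite row_mul rowK mulmxBr !mulmxA.
    rewrite (ek _ _ _ _ kw) // -!(mulmxA _ (N ^+ i) N) -powSr.
    have [lt|ge] := ltnP i.+1 m; first by rewrite (ek _ _ _ _ kw) // subrr sub0mx.
    have -> : i.+1 = m by apply/eqP; rewrite eqn_leq ge ltn_ord.
    by rewrite addmx_sub // eqmx_opp fixU.
  have BU : (B *m (w *m N - N *m w) <= U)%MS.
    rewrite /B !mul_col_mx -addsmxE addsmx_sub -addsmxE addsmx_sub.
    rewrite (kr _ _ _ ew) // (kr _ _ _ yw) // !andbT.
    have bU : (row_base U *m N <= U)%MS.
      by apply: submx_trans s1; rewrite (eqmxMr N (eq_row_base U)).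
    by rewrite mulmxBr !mulmxA Uw (fixU _ _ bU) subrr sub0mx.
  rewrite -[w *m N - _]mul1mx -(mulVpmx Bfull) -mulmxA.
  exact: submx_trans (submxMl _ _) BU.
Qed.

(** [U *m w = U] is an equality of matrices, so [w] fixes every vector of [U]; on $V/U$ it induces
    an automorphism commuting with [N]. *)
Definition fixes U (w : 'M[K]_n) :=
  [/\ w \in unitmx, U *m w = U & (w *m N - N *m w <= U)%MS].

Lemma fixes_inv U w : fixes U w -> fixes U (invmx w).
Proof.
move=> [w1 w2 w3]; split; first by rewrite unitmx_inv.
  by rewrite -{1}w2 mulmxK.
have -> : invmx w *m N - N *m invmx w = - (invmx w *m (w *m N - N *m w) *m invmx w).
  by rewrite mulmxBr !mulmxA mulVmx // mul1mx mulmxBl mulmxK // opprB.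
rewrite eqmx_opp -mulmxA (submx_trans (submxMl _ _)) //.
have UV : U *m invmx w = U by rewrite -{1}w2 mulmxK.
by rewrite -[X in (_ <= X)%MS]UV submxMr.
Qed.

Lemma fixes_sub m U w (x : 'M_(m, n)) : fixes U w -> (x <= U)%MS -> x *m w = x.
Proof. by move=> [_ w2 _] /submxP[D ->]; rewrite -mulmxA w2. Qed.

Lemma fixes_act U w v p : (U *m N <= U)%MS -> fixes U w ->
  (act (v *m w) p - act v p *m w <= U)%MS.
Proof.
move=> sU fw; elim/poly_ind: p => [|p c IH].
  by rewrite /act !(rmorph0 (horner_mx N)) !mulmx0 mul0mx subrr sub0mx.
have [_ _ w3] := fw.
have -> : act (v *m w) (p * 'X + c%:P) - act v (p * 'X + c%:P) *m w =
   (act (v *m w) p - act v p *m w) *m N + act v p *m (w *m N - N *m w).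
  rewrite !actD !actM !actC !actX mulmxDl -scalemxAl mulmxBl mulmxBr !mulmxA.
  by zmod_row.
apply: addmx_sub; first by apply: submx_trans sU; exact: submxMr.
exact: submx_trans (submxMl _ _) w3.
Qed.

(** The automorphism of $V/U$ induced by [w] carries the frame along; the failure of exact
    commutation stays inside [U], hence inside [W *m w]. *)
Lemma frame_fixes U W w a b e y : (U *m N <= U)%MS -> fixes U w -> (U <= W)%MS ->
  frame W a b e y -> frame (W *m w) a b (e *m w) (y *m w).
Proof.
move=> sU fw UW [s1 s2 s3 s4 s5]; have [w1 w2 w3] := fw.
have UWw : (U <= W *m w)%MS by rewrite -w2 submxMr.
have move_act v p : (act v p <= W)%MS -> (act (v *m w) p <= W *m w)%MS.
  move=> vW; rewrite -(subrK (act v p *m w) (act (v *m w) p)) addmx_sub //.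
    exact: submx_trans (fixes_act _ _ sU fw) UWw.
  exact: submxMr.
split.
- have -> : W *m w *m N = W *m N *m w + W *m (w *m N - N *m w).
    by rewrite mulmxBr !mulmxA addrC subrK.
  rewrite addmx_sub ?submxMr //; apply: submx_trans (submxMl _ _) _.
  exact: submx_trans w3 UWw.
- by rewrite -actXn move_act // actXn.
- by rewrite -actXn move_act // actXn.
- move=> v; have [p [q s]] := s4 (v *m invmx w); exists p, q.
  have -> : v - act (e *m w) p - act (y *m w) q =
    (v *m invmx w - act e p - act y q) *m w
    - (act (e *m w) p - act e p *m w) - (act (y *m w) q - act y q *m w).
    by rewrite !mulmxBl mulmxKV //; zmod_row.
  apply: addmx_sub; first apply: addmx_sub; rewrite ?eqmx_opp.
  + exact: submxMr.
  + exact: submx_trans (fixes_act _ _ sU fw) UWw.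
  + exact: submx_trans (fixes_act _ _ sU fw) UWw.
- move=> p q s; apply: s5; rewrite -(submxMfree _ _ (C := w)) ?row_free_unit //.
  have -> : (act e p + act y q) *m w = (act (e *m w) p + act (y *m w) q)
    - (act (e *m w) p - act e p *m w) - (act (y *m w) q - act y q *m w).
    by rewrite !mulmxDl; zmod_row.
  apply: addmx_sub; first apply: addmx_sub; rewrite ?eqmx_opp //.
  + exact: submx_trans (fixes_act _ _ sU fw) UWw.
  + exact: submx_trans (fixes_act _ _ sU fw) UWw.
Qed.

(** The kernel of [N] is spanned by two chain ends, so each application of [N] lowers a rank by at
    most two. *)
Lemma rank_le_kernel m (X : 'M[K]_(m, n)) a b e y i : frame 0 a b e y ->
  (\rank X <= \rank (X *m N ^+ i) + i.*2)%N.
Proof.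
move=> fr.
have step m1 (Y : 'M[K]_(m1, n)) : (\rank Y <= \rank (Y *m N) + 2)%N.
  rewrite -(mxrank_mul_ker Y N) leq_add2l.
  have kerN : (kermx N <= e *m N ^+ a.-1 + y *m N ^+ b.-1)%MS.
    apply/row_subP => j; have : (row j (kermx N) *m N <= (0 : 'M_n))%MS.
      by rewrite -row_mul mulmx_ker row0 sub0mx.
    move/(frame_kernel fr) => [c [d]]; rewrite submx0 => /eqP eq.
    have -> : row j (kermx N) = c *: (e *m N ^+ a.-1) + d *: (y *m N ^+ b.-1).
      by rewrite -[LHS]subr0 -eq; zmod_row.
    by apply: addmx_sub_adds; exact: scalemx_sub.
  apply: leq_trans (mxrankS (capmxSr _ _)) (leq_trans (mxrankS kerN) _).
  apply: leq_trans (mxrank_adds_leqif _ _) _.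
  exact: (@leq_add _ _ 1 1) (rank_leq_row _) (rank_leq_row _).
elim: i => [|i IH]; first by rewrite expr0 mulmx1 addn0.
have := step _ (X *m N ^+ i); rewrite powSr mulmxA doubleS; clear -IH.
by move: IH; set r1 := \rank _; set r2 := \rank _; set r3 := \rank _; lia.
Qed.

End Frames.

(** * The Jordan type of the given nilpotent map *)

Section BaseFrame.
Variables (n' k : nat).
Local Notation n := n'.+1.
Hypothesis kn : (k < n)%N.

Lemma mulNmxE (v : 'rV[C]_n) (c : 'I_n) : (v *m Nmx n k) 0 c =
  if (c.+1 < n)%N && (c.+1 != n - k)%N then v 0 (inord c.+1) else 0.
Proof.
rewrite mxE; case: ifP => [/andP[lt ne]|no].
  rewrite (bigD1 (inord c.+1)) //= big1 ?addr0 => [|i ni].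
    by rewrite mxE inordK // eqxx ne mulr1.
  rewrite mxE; case: eqP => [eq|_]; last by rewrite mulr0.
  by case/eqP: ni; apply: val_inj; rewrite /= inordK.
rewrite big1 // => i _; rewrite mxE; case: eqP => [eq|_]; last by rewrite mulr0.
by rewrite eq; move: no; rewrite -eq ltn_ord /= => ->; rewrite mulr0.
Qed.

(** [N] lowers the index by one along each chain, so the coefficients of [p] appear as coordinates
    in reverse order, cut off at the start of the chain. The pair [(lo, hi)] selects the [e]-chain
    or the [f]-chain. *)
Lemma act_chain (lo hi : nat) (i0 : 'I_n) p (c : 'I_n) :
  (lo, hi) = (0%N, n - k)%N \/ (lo, hi) = (n - k, n)%N ->
  (lo < hi)%N -> i0 = hi.-1 :> nat ->
  act (Nmx n k) (delta_mx 0 i0) p 0 c =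
   if (lo <= c < hi)%N then p`_(hi.-1 - c) else 0.
Proof.
move=> lohi lt ei0.
elim/poly_ind: p c => [|p d IH] c.
  by rewrite /act (rmorph0 (horner_mx _)) mulmx0 mxE coef0 if_same.
have dE : (d *: delta_mx 0 i0 : 'rV[C]_n) 0 c = if (c == hi.-1 :> nat) then d else 0.
  by rewrite !mxE eqxx /= -val_eqE /= ei0; case: eqP; rewrite ?mulr1 ?mulr0.
rewrite actD actM actX actC mxE mulNmxE dE IH coefD coefMX coefC.
have := ltn_ord c; rewrite -subn_eq0.
case: lohi => -[elo ehi]; move: lt ei0; rewrite elo ehi => lt ei0 ltc.
- case: ifP => [/andP[h1 h2]|h]; rewrite ?inordK //.
  + have -> : ((n - k).-1 - c.+1 = ((n - k).-1 - c).-1)%N by lia.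
    by repeat case: ifP => ?; rewrite ?addr0 ?add0r //; lia.
  + by repeat case: ifP => ?; rewrite ?addr0 ?add0r //; lia.
- case: ifP => [/andP[h1 h2]|h]; rewrite ?inordK //.
  + have -> : (n.-1 - c.+1 = (n.-1 - c).-1)%N by lia.
    by repeat case: ifP => ?; rewrite ?addr0 ?add0r //; lia.
  + by repeat case: ifP => ?; rewrite ?addr0 ?add0r //; lia.
Qed.

Lemma dvdp_Xn (R : fieldType) m (p : {poly R}) :
  (forall i, (i < m)%N -> p`_i = 0) -> 'X^m %| p.
Proof.
move=> h; rewrite -(poly_take_drop m p).
suff -> : take_poly m p = 0 by rewrite add0r dvdp_mulIr.
by apply/polyP => i; rewrite coef_take_poly coef0; case: ifP => // /h.
Qed.

Lemma frame_base : exists e y, frame (Nmx n k) 0 (n - k) k e y.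
Proof.
have addE (u v : 'rV[C]_n) c : (u + v) 0 c = u 0 c + v 0 c by rewrite mxE.
have subE (u v : 'rV[C]_n) c : (u - v) 0 c = u 0 c - v 0 c by rewrite !mxE.
have zeroE c : (0 : 'rV[C]_n) 0 c = 0 by rewrite mxE.
pose e : 'rV[C]_n := delta_mx 0 (inord (n - k).-1).
(* For [k = 0] the second chain is empty, and the zero vector generates it. *)
pose y : 'rV[C]_n := if k == 0%N then 0 else delta_mx 0 (inord n.-1).
have eE p c : act (Nmx n k) e p 0 c = if (c < n - k)%N then p`_((n - k).-1 - c) else 0.
  have i0 : (inord (n - k).-1 : 'I_n) = (n - k).-1 :> nat by rewrite inordK //; lia.
  by rewrite (act_chain p c (or_introl erefl) _ i0) //; lia.
have yE p c : act (Nmx n k) y p 0 c = if (n - k <= c)%N then p`_(n.-1 - c) else 0.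
  rewrite /y; case: eqP => k0.
    by rewrite /act mul0mx mxE; case: ifP => //; have := ltn_ord c; lia.
  have i0 : (inord n.-1 : 'I_n) = n.-1 :> nat by exact: inordK.
  rewrite (act_chain p c (or_intror erefl) _ i0) ?ltn_ord ?andbT //.
  by lia.
exists e, y; split.
- by rewrite mul0mx sub0mx.
- rewrite submx0 -actXn; apply/eqP/rowP => c; rewrite eE zeroE coefXn.
  by case: ifP => // lt; case: eqP => //; lia.
- rewrite submx0 -actXn; apply/eqP/rowP => c; rewrite yE zeroE coefXn.
  by case: ifP => // lt; case: eqP => //; have := ltn_ord c; lia.
- move=> v; exists (\poly_(i < n - k) v 0 (inord ((n - k).-1 - i))),
             (\poly_(i < k) v 0 (inord (n.-1 - i))).
  rewrite submx0; apply/eqP/rowP => c; rewrite !subE zeroE eE yE !coef_poly.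
  have ltc := ltn_ord c.
  case: ltnP => h.
    have -> : ((n - k).-1 - c < n - k)%N by lia.
    have -> : ((n - k).-1 - ((n - k).-1 - c))%N = c by lia.
    by rewrite inord_val subr0 subrr.
  have -> : (n.-1 - c < k)%N by lia.
  have -> : (n.-1 - (n.-1 - c))%N = c by lia.
  by rewrite inord_val subr0 subrr.
- move=> p q; rewrite submx0 => /eqP/rowP pq0.
  apply/andP; split; apply: dvdp_Xn => i lti.
    have := pq0 (inord ((n - k).-1 - i)); rewrite addE zeroE eE yE inordK; last by lia.
    have -> : ((n - k).-1 - i < n - k)%N by lia.
    have -> : (n - k <= (n - k).-1 - i)%N = false by lia.
    by rewrite addr0 => h; rewrite -[RHS]h; congr (p`_ _); lia.
  have := pq0 (inord (n.-1 - i)); rewrite addE zeroE eE yE inordK; last by lia.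
  have -> : (n.-1 - i < n - k)%N = false by lia.
  have -> : (n - k <= n.-1 - i)%N by lia.
  by rewrite add0r => h; rewrite -[RHS]h; congr (q`_ _); lia.
Qed.

End BaseFrame.

(** * Flags and the Zariski topology *)

(** The prepended zero matches [flag_prev], which counts levels from the zero subspace: level [l]
    has dimension $i_l$, with $i_0 = 0$. *)
Definition flag_dim (t : seq nat) (l : nat) : nat := nth 0%N (0%N :: t) l.
Arguments flag_dim : simpl never.

Section Types.
Variables (n : nat) (t : seq nat).
Hypothesis vt : valid_type n t.

Lemma flag_dim_lt l l' : (l < l' <= size t)%N -> (flag_dim t l < flag_dim t l')%N.
Proof.
move=> /andP[ll' l't]; have [_ [st _]] := vt.
by apply: (sorted_ltn_nth ltn_trans 0%N st) => //; rewrite inE /= ltnS //; lia.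
Qed.

Lemma flag_dim_le l l' : (l <= l' <= size t)%N -> (flag_dim t l <= flag_dim t l')%N.
Proof.
rewrite leq_eqVlt => /andP[/orP[/eqP->//|ll'] l't].
by apply/ltnW/flag_dim_lt; rewrite ll'.
Qed.

Lemma flag_dim_last : flag_dim t (size t) = n.
Proof. by have [_ [_ <-]] := vt; rewrite /flag_dim -[size t]/(size (0%N :: t)).-1 nth_last. Qed.

Lemma flag_dim_max l : (l <= size t)%N -> (flag_dim t l <= n)%N.
Proof. by move=> lt; rewrite -flag_dim_last flag_dim_le // lt leqnn. Qed.

Lemma flag_dim_mem l : (0 < l <= size t)%N -> flag_dim t l \in t.
Proof. by case: l => // l lt; rewrite /flag_dim /= mem_nth. Qed.

Lemma mem_flag_dim d : d \in t -> exists2 l, (0 < l <= size t)%N & d = flag_dim t l.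
Proof.
move=> dt; exists (index d t).+1; first by rewrite /= index_mem.
by rewrite /flag_dim /= nth_index.
Qed.

Lemma type_gt0 : (0 < size t)%N.
Proof. by have [] := vt; case: t. Qed.

End Types.

Section Flags.
Variables (n : nat) (t : seq nat).
Hypothesis vt : valid_type n t.
Implicit Types (F P : seq 'M[C]_n) (g h w : 'M[C]_n).

Local Notation top_rows d g := ((pid_mx d : 'M[C]_n) *m g).

Lemma pid_mulE d g i : row i (top_rows d g) = if (i < d)%N then row i g else 0.
Proof.
apply/rowP => j; rewrite !mxE (bigD1 i) //= big1 ?addr0 => [|i' ni].
  by rewrite mxE eqxx /=; case: ifP => _; rewrite !mxE ?mul1r ?mul0r.
by rewrite mxE eq_sym -[_ == _ :> nat]/(i' == i) (negPf ni) mul0r.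
Qed.

Lemma pid_mul_subP d g m (U : 'M[C]_(m, n)) :
  reflect (forall i : 'I_n, (i < d)%N -> (row i g <= U)%MS)
          (top_rows d g <= U)%MS.
Proof.
apply: (iffP row_subP) => [h i lt|h i]; first by have := h i; rewrite pid_mulE lt.
by rewrite pid_mulE; case: ifP => [/h //|_]; exact: sub0mx.
Qed.

Lemma row_sub_pid d g (i : 'I_n) : (i < d)%N -> (row i g <= top_rows d g)%MS.
Proof. by move=> lt; have := row_sub i (top_rows d g); rewrite pid_mulE lt. Qed.

Lemma pid_mulS g (i : 'I_n) :
  (top_rows i.+1 g :=: top_rows i g + row i g)%MS.
Proof.
apply/eqmxP/andP; split.
  apply/pid_mul_subP => j; rewrite ltnS leq_eqVlt => /orP[/eqP eq|lt].
    by rewrite (_ : j = i) ?addsmxSr //; exact: val_inj.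
  exact: submx_trans (row_sub_pid g lt) (addsmxSl _ _).
rewrite addsmx_sub row_sub_pid // andbT; apply/pid_mul_subP => j lt.
by apply: row_sub_pid; exact: ltnW.
Qed.

Lemma pid_mul_le d d' g : (d <= d')%N -> (top_rows d g <= top_rows d' g)%MS.
Proof.
by move=> le; apply/pid_mul_subP => i lt; apply: row_sub_pid; exact: leq_trans le.
Qed.

Lemma rank_pid_mul d g : g \in unitmx -> (d <= n)%N ->
  \rank (top_rows d g) = d.
Proof. by move=> ug dn; rewrite mxrankMfree ?row_free_unit ?rank_pid_mx. Qed.

Lemma flag_rank F l : is_flag t F -> (l <= size t)%N ->
  \rank (flag_prev F l) = flag_dim t l.
Proof.
move=> [_ [h _]]; case: l => [|l] lt; first by rewrite mxrank0.
by have [_ ->] := h _ lt.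
Qed.

Lemma flag_genmx F l : is_flag t F -> (l <= size t)%N ->
  <<flag_prev F l>>%MS = flag_prev F l.
Proof.
move=> [_ [h _]]; case: l => [|l] lt; first by rewrite /= genmx0.
by have [-> _] := h _ lt.
Qed.

Lemma flag_sub1 F l : is_flag t F -> (l < size t)%N ->
  (flag_prev F l <= flag_prev F l.+1)%MS.
Proof. by move=> [_ [_ h]]; case: l => [|l] lt; [exact: sub0mx|exact: h]. Qed.

Lemma flag_sub F l l' : is_flag t F -> (l <= l' <= size t)%N ->
  (flag_prev F l <= flag_prev F l')%MS.
Proof.
move=> fF; elim: l' => [|l' IH]; first by case: l => // _; exact: submx_refl.
rewrite leq_eqVlt => /andP[/orP[/eqP->//|ll'] l't].
by apply: submx_trans (IH _) (flag_sub1 fF _) => //; lia.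
Qed.

Lemma flag_ext F P : size F = size t -> size P = size t ->
  (forall l, (l <= size t)%N -> flag_prev F l = flag_prev P l) -> F = P.
Proof.
move=> sF sP h; apply: (@eq_from_nth _ 0); rewrite sF ?sP // => l lt.
exact: (h l.+1).
Qed.

Lemma flag_of_prev g l : (l <= size t)%N ->
  flag_prev (flag_of t g) l = <<top_rows (flag_dim t l) g>>%MS.
Proof.
case: l => [|l] lt; last by rewrite /= (nth_map 0%N).
by rewrite /= /flag_dim /= pid_mx_0 mul0mx genmx0.
Qed.

Lemma flag_of_flag g : g \in unitmx -> is_flag t (flag_of t g).
Proof.
move=> ug; split; first by rewrite size_map.
split=> l lt; first split.
- by rewrite (nth_map 0%N) // genmx_id.
- rewrite (nth_map 0%N) // genmxE rank_pid_mul //.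
  exact: (flag_dim_max vt (l := l.+1)).
- change (flag_prev (flag_of t g) l.+1 <= flag_prev (flag_of t g) l.+2)%MS.
  rewrite (flag_of_prev g (l := l.+1)) 1?ltnW //.
  rewrite (flag_of_prev g (l := l.+2)) // !genmxE pid_mul_le //.
  by apply: (flag_dim_le vt); rewrite lt leqnSn.
Qed.

(** Each level is extended by a row basis of a complement of the previous one. Only spanning is
    recorded; invertibility comes later from the last level, where $n$ rows span $V$. *)
Lemma flag_rows F : is_flag t F -> forall l, (l <= size t)%N ->
  exists r : nat -> 'rV[C]_n, forall l', (l' <= l)%N ->
    (flag_prev F l' <= \matrix_(i < flag_dim t l') r i)%MS.
Proof.
move=> fF; elim=> [|l IH] lt.
  by exists (fun _ => 0) => l'; rewrite leqn0 => /eqP->; exact: sub0mx.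
have [r hr] := IH (ltnW lt).
set U := flag_prev F l; set W := flag_prev F l.+1.
have UW : (U <= W)%MS by exact: flag_sub1.
pose D := (W :\: U)%MS.
have rD : (\rank D + flag_dim t l)%N = flag_dim t l.+1.
  rewrite -(flag_rank fF lt) -(flag_rank fF (ltnW lt)) -/U -/W.
  by rewrite -(mxrank_cap_compl W U) (capmx_idPr UW) addnC.
pose r' i := if (i < flag_dim t l)%N then r i else
  if insub (i - flag_dim t l)%N is Some j then row j (row_base D) else 0.
exists r' => l'; rewrite leq_eqVlt => /orP[/eqP->|ll'].
  have Ur : (U <= \matrix_(i < flag_dim t l.+1) r' i)%MS.
    apply: submx_trans (hr l (leqnn l)) _.
    apply/row_subP => i; rewrite rowK.
    have lti : (i < flag_dim t l.+1)%N by rewrite -rD ltn_addl.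
    have -> : r i = row (Ordinal lti) (\matrix_(i < flag_dim t l.+1) r' i).
      by rewrite rowK /r' /= ltn_ord.
    exact: row_sub.
  rewrite -/W -(addsmx_diff_cap_eq W U) addsmx_sub.
  rewrite (submx_trans (capmxSr _ _) Ur) andbT -/D -(eq_row_base D).
  apply/row_subP => j.
  have lti : (j + flag_dim t l < flag_dim t l.+1)%N by rewrite -rD ltn_add2r.
  have -> : row j (row_base D) = row (Ordinal lti) (\matrix_(i < flag_dim t l.+1) r' i).
    rewrite rowK /r' /= ltnNge leq_addl /= addnK insubT // => ltj.
    by congr (row _ _); exact: val_inj.
  exact: row_sub.
apply: submx_trans (hr l' ll') _.
have -> : \matrix_(i < flag_dim t l') r' i = \matrix_(i < flag_dim t l') r i.
  apply/row_matrixP => i; rewrite !rowK /r'.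
  have -> // : (i < flag_dim t l)%N.
  by apply: leq_trans (ltn_ord i) (flag_dim_le vt _); rewrite -ltnS ll' ltnW.
exact: submx_refl.
Qed.

Lemma flag_of_surj F : is_flag t F ->
  exists2 g, g \in unitmx & F = flag_of t g.
Proof.
move=> fF; have [r hr] := flag_rows fF (leqnn _).
pose g : 'M[C]_n := \matrix_(i < n) r i.
have sub l : (l <= size t)%N -> (flag_prev F l <= top_rows (flag_dim t l) g)%MS.
  move=> lt; apply: submx_trans (hr l lt) _; apply/row_subP => i; rewrite rowK.
  have lti : (i < n)%N by apply: leq_trans (ltn_ord i) (flag_dim_max vt lt).
  have -> : r i = row (Ordinal lti) g by rewrite rowK.
  exact: (@row_sub_pid _ g (Ordinal lti) (ltn_ord i)).
have ug : g \in unitmx.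
  rewrite -row_full_unit /row_full eqn_leq rank_leq_col.
  rewrite -{1}(flag_dim_last vt) -(flag_rank fF (leqnn _)) mxrankS //.
  exact: submx_trans (sub _ (leqnn _)) (submxMl _ _).
exists g => //; apply: flag_ext; [by case: fF|by rewrite size_map|] => l lt.
rewrite flag_of_prev // -(flag_genmx fF lt); apply/genmxP.
rewrite -(mxrank_leqif_eq (sub l lt)) rank_pid_mul ?(flag_dim_max vt) //.
by rewrite (flag_rank fF lt).
Qed.

(** $g' g^{-1}$ lies in the parabolic subgroup stabilising the coordinate flag of type [t], and left
    multiplication by it preserves the relevant spans of leading rows. *)
Lemma flag_of_mul_eq g g' h : g \in unitmx -> g' \in unitmx ->
  flag_of t g' = flag_of t g -> flag_of t (g' *m invmx g *m h) = flag_of t h.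
Proof.
move=> ug ug' eqf; apply: flag_ext; rewrite ?size_map // => l lt.
have := congr1 (fun F => flag_prev F l) eqf; rewrite !flag_of_prev //.
move/genmxP/eqmxP => eq1; apply/genmxP/eqmxP.
rewrite !mulmxA; apply: eqmx_trans (eqmxMr h (eqmxMr (invmx g) eq1)) _.
by rewrite mulmxK.
Qed.

End Flags.

(** * Polynomial functions of the matrix entries *)

Section PolynomialFunctions.
Variable n : nat.
Implicit Types (f : 'M[C]_n -> C).

(** [polyfun] up to pointwise equality, so that expansions of products and determinants can be used
    without functional extensionality. *)
Definition polyrep f := exists q, polyfun q /\ q =1 f.

Lemma polyrep_fun f : polyfun f -> polyrep f.
Proof. by move=> pf; exists f. Qed.

Lemma polyrep_eq f f' : f =1 f' -> polyrep f -> polyrep f'.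
Proof. by move=> eqf [q [pq qf]]; exists q; split=> // g; rewrite qf. Qed.

Lemma polyrep_cst c : polyrep (fun _ => c).
Proof. exact/polyrep_fun/pf_cst. Qed.

Lemma polyrep_coord i j : polyrep (fun g => g i j).
Proof. exact/polyrep_fun/pf_coord. Qed.

Lemma polyrep_add f f' : polyrep f -> polyrep f' -> polyrep (fun g => f g + f' g).
Proof.
move=> [q [pq e]] [q' [pq' e']]; exists (fun g => q g + q' g); split.
  exact: pf_add.
by move=> g; rewrite e e'.
Qed.

Lemma polyrep_mul f f' : polyrep f -> polyrep f' -> polyrep (fun g => f g * f' g).
Proof.
move=> [q [pq e]] [q' [pq' e']]; exists (fun g => q g * q' g); split.
  exact: pf_mul.
by move=> g; rewrite e e'.
Qed.

Lemma polyrep_sum I (s : seq I) (F : I -> 'M[C]_n -> C) :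
  (forall i, polyrep (F i)) -> polyrep (fun g => \sum_(i <- s) F i g).
Proof.
move=> hF; elim: s => [|i s IH].
  by apply: polyrep_eq (polyrep_cst 0) => g; rewrite big_nil.
by apply: polyrep_eq (polyrep_add (hF i) IH) => g; rewrite big_cons.
Qed.

Lemma polyrep_prod I (s : seq I) (F : I -> 'M[C]_n -> C) :
  (forall i, polyrep (F i)) -> polyrep (fun g => \prod_(i <- s) F i g).
Proof.
move=> hF; elim: s => [|i s IH].
  by apply: polyrep_eq (polyrep_cst 1) => g; rewrite big_nil.
by apply: polyrep_eq (polyrep_mul (hF i) IH) => g; rewrite big_cons.
Qed.

Definition polymx m p (A : 'M[C]_n -> 'M[C]_(m, p)) :=
  forall i j, polyrep (fun g => A g i j).

Lemma polymx_cst m p (A : 'M[C]_(m, p)) : polymx (fun _ => A).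
Proof. by move=> i j; exact: polyrep_cst. Qed.

Lemma polymx_id : polymx (fun g => g).
Proof. by move=> i j; exact: polyrep_coord. Qed.

Lemma polymx_mul m p q (A : 'M[C]_n -> 'M[C]_(m, p)) (B : 'M[C]_n -> 'M[C]_(p, q)) :
  polymx A -> polymx B -> polymx (fun g => A g *m B g).
Proof.
move=> pA pB i j.
apply: polyrep_eq (polyrep_sum (index_enum _) (fun l => polyrep_mul (pA i l) (pB l j))).
by move=> g; rewrite mxE.
Qed.

Lemma polyrep_det m (A : 'M[C]_n -> 'M[C]_m) :
  polymx A -> polyrep (fun g => \det (A g)).
Proof.
move=> pA; apply: polyrep_sum => s; apply: polyrep_mul; first exact: polyrep_cst.
by apply: polyrep_prod => i; exact: pA.
Qed.

Lemma polymx_adj m (A : 'M[C]_n -> 'M[C]_m) : polymx A -> polymx (fun g => \adj (A g)).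
Proof.
move=> pA i j.
apply: (@polyrep_eq (fun g => (-1) ^+ (j + i) * \det (row' j (col' i (A g))))).
  by move=> g; rewrite mxE.
apply: polyrep_mul; first exact: polyrep_cst.
apply: polyrep_det => i' j'.
by apply: polyrep_eq (pA _ _) => g; rewrite !mxE.
Qed.

Lemma polyfun_polymx f (A : 'M[C]_n -> 'M[C]_n) :
  polyfun f -> polymx A -> polyrep (fun g => f (A g)).
Proof.
move=> pf pA; elim: pf => [c|i j|p q _ IHp _ IHq|p q _ IHp _ IHq].
- exact: polyrep_cst.
- exact: pA.
- exact: polyrep_add.
- exact: polyrep_mul.
Qed.

Lemma polyfun_curve f (G : 'M[{poly C}]_n) : polyfun f ->
  exists q : {poly C}, forall s, f (map_mx (horner_eval s) G) = q.[s].
Proof.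
elim=> [c|i j|p q _ [p' hp] _ [q' hq]|p q _ [p' hp] _ [q' hq]].
- by exists c%:P => s; rewrite hornerC.
- by exists (G i j) => s; rewrite mxE.
- by exists (p' + q') => s; rewrite hp hq hornerD.
- by exists (p' * q') => s; rewrite hp hq hornerM.
Qed.

End PolynomialFunctions.

(** * Closed sets of flags, closures and irreducibility *)

Section ZariskiClosed.
Variables (n : nat) (t : seq nat).
Hypothesis vt : valid_type n t.
Implicit Types (A B Z : seq 'M[C]_n -> Prop) (F P Q : seq 'M[C]_n) (g : 'M[C]_n).
Local Notation top_rows d g := ((pid_mx d : 'M[C]_n) *m g).

Lemma zclosedI (I : Type) (f : I -> 'M[C]_n -> C) A :
  (forall F, A F -> is_flag t F) -> (forall i, polyrep (f i)) ->
  (forall g, g \in unitmx -> A (flag_of t g) <-> forall i, f i g = 0) ->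
  zclosed t A.
Proof.
move=> Af pf Aiff; split=> //.
exists (fun p => polyfun p /\ exists i, p =1 f i); split=> [p [] //|g ug].
split=> [/(Aiff g ug) fg p [_ [i ->]] //|h].
apply/(Aiff g ug) => i; have [q [pq qf]] := pf i.
by rewrite -qf; apply: h; split=> //; exists i.
Qed.

Lemma zclosed_empty : zclosed t (fun _ : seq 'M[C]_n => False).
Proof.
apply: (@zclosedI unit (fun _ _ => 1)) => //; first by move=> _; exact: polyrep_cst.
by move=> g _; split=> // /(_ tt)/eqP; rewrite oner_eq0.
Qed.

(** Products of one equation from each family cut out the union: if some equation of one family is
    nonzero at a point, all those of the other vanish there. *)
Lemma zclosedU A B : zclosed t A -> zclosed t B -> zclosed t (fun F => A F \/ B F).
Proof.
move=> [Af [S [pS AS]]] [Bf [S' [pS' BS']]].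
pose I := {p : ('M[C]_n -> C) * ('M[C]_n -> C) | S p.1 /\ S' p.2}.
apply: (@zclosedI I (fun i g => (sval i).1 g * (sval i).2 g)).
- by move=> F [/Af|/Bf].
- by move=> [[p q] /= [Sp Sq]]; apply: polyrep_mul; apply: polyrep_fun; [exact: pS|exact: pS'].
- move=> g ug; rewrite (AS g ug) (BS' g ug); split.
    move=> [h|h] [[p q] /= [Sp Sq]]; first by rewrite (h _ Sp) mul0r.
    by rewrite (h _ Sq) mulr0.
  move=> h; case: (classic (forall p, S p -> p g = 0)) => [|nS]; first by left.
  right=> q Sq; apply/eqP/negPn/negP => q0; apply: nS => p Sp.
  have /= /eqP := h (exist _ (p, q) (conj Sp Sq)).
  by rewrite mulf_eq0 (negPf q0) orbF => /eqP.
Qed.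

Lemma zclosed_map_sub l m (M : 'M[C]_n) (W : 'M[C]_(m, n)) : (l <= size t)%N ->
  zclosed t (fun F => is_flag t F /\ (flag_prev F l *m M <= W)%MS).
Proof.
move=> lt; apply: (@zclosedI ('I_n * 'I_n)
  (fun ij g => (top_rows (flag_dim t l) g *m M *m cokermx W) ij.1 ij.2)).
- by move=> F [].
- move=> [i j] /=; apply: polymx_mul; last exact: polymx_cst.
  apply: polymx_mul; last exact: polymx_cst.
  by apply: polymx_mul; [exact: polymx_cst|exact: polymx_id].
- move=> g ug; rewrite flag_of_prev // (eqmxMr M (genmxE _)) submxE.
  split=> [[_ /eqP h] ij|h]; first by rewrite h mxE.
  split; first exact: flag_of_flag.
  by apply/eqP/matrixP => i j; rewrite (h (i, j)) mxE.
Qed.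

Lemma pid_subP m d (A : 'M[C]_(m, n)) :
  (A <= (pid_mx d : 'M[C]_n))%MS = (A *m copid_mx d == 0).
Proof.
have idem : (pid_mx d : 'M[C]_n) *m (pid_mx d : 'M[C]_n) = pid_mx d.
  apply/row_matrixP => i; rewrite pid_mulE -[in RHS](mulmx1 (pid_mx d)) pid_mulE.
  by case: ifP => // lt; rewrite -[in LHS](mulmx1 (pid_mx d)) pid_mulE lt.
apply/idP/eqP => [/submxP[D ->]|].
  by rewrite /copid_mx mulmxBr mulmx1 -mulmxA idem subrr.
rewrite /copid_mx mulmxBr mulmx1 => /eqP; rewrite subr_eq0 => /eqP ->.
exact: submxMl.
Qed.

(** Inclusion in a span of leading rows of [g] is tested after multiplying by $g^{-1}$, where it
    says that the trailing columns vanish. The adjugate replaces the inverse: its entries are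
    polynomial and it differs by a nonzero factor. *)
Lemma zclosed_map_flag l l' (M : 'M[C]_n) : (l <= size t)%N -> (l' <= size t)%N ->
  zclosed t (fun F => is_flag t F /\ (flag_prev F l *m M <= flag_prev F l')%MS).
Proof.
move=> lt lt'; apply: (@zclosedI ('I_n * 'I_n)
  (fun ij g => (top_rows (flag_dim t l) g *m M *m \adj g *m
     copid_mx (flag_dim t l')) ij.1 ij.2)).
- by move=> F [].
- move=> [i j] /=; apply: polymx_mul; last exact: polymx_cst.
  apply: polymx_mul; last by apply: polymx_adj; exact: polymx_id.
  apply: polymx_mul; last exact: polymx_cst.
  by apply: polymx_mul; [exact: polymx_cst|exact: polymx_id].
- move=> g ug; rewrite !flag_of_prev // (eqmxMr M (genmxE _)) genmxE.
  have dg : \det g != 0 by rewrite -unitfE -unitmxE.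
  have -> : (top_rows (flag_dim t l) g *m M <= top_rows (flag_dim t l') g)%MS =
     (top_rows (flag_dim t l) g *m M *m \adj g *m copid_mx (flag_dim t l') == 0).
    have -> : \adj g = \det g *: invmx g.
      by rewrite /invmx ug scalerA divff // scale1r.
    rewrite -scalemxAr -scalemxAl scaler_eq0 (negPf dg) /= -pid_subP.
    by rewrite -[RHS](submxMfree _ _ (C := g)) ?row_free_unit // mulmxKV.
  split=> [[_ /eqP h] ij|h]; first by rewrite h mxE.
  split; first exact: flag_of_flag.
  by apply/eqP/matrixP => i j; rewrite (h (i, j)) mxE.
Qed.

Lemma zclosure_sub A : (forall F, A F -> is_flag t F) -> subset_of A (zclosure t A).
Proof. by move=> Af F AF; split; [exact: Af|move=> Z _; exact]. Qed.

Lemma zclosure_min A Z : zclosed t Z -> subset_of A Z -> subset_of (zclosure t A) Z.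
Proof. by move=> cZ AZ F [_]; exact. Qed.

(** The equations are all polynomials vanishing on the preimage of [A]. Their zero set is a union of
    fibres of $GL_n \to$ flags, since translating such an equation by the parabolic subgroup gives
    another one. *)
Lemma zclosed_zclosure A : (forall F, A F -> is_flag t F) -> zclosed t (zclosure t A).
Proof.
move=> Af; pose S p := polyfun p /\ forall g, g \in unitmx -> A (flag_of t g) -> p g = 0.
split=> [F []//|]; exists S; split=> [p []//|g ug].
split=> [[_ h] p [pp Ap]|h].
  (* The vanishing is required at every matrix representing [F], so that it is a condition on the
     flag. *)
  pose Z F := is_flag t F /\
    forall g, g \in unitmx -> F = flag_of t g -> forall p, S p -> p g = 0.
  have cZ : zclosed t Z.
    split=> [F []//|]; exists S; split=> [q []//|g1 ug1].
    split=> [[_ ] /(_ g1 ug1 erefl) //|hS]; split; first exact: flag_of_flag.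
    move=> g2 ug2 eqf q [pq Aq].
    have [q' [pq' eq']] : polyrep (fun h => q (g2 *m invmx g1 *m h)).
      apply: polyfun_polymx => //.
      by apply: polymx_mul; [exact: polymx_cst|exact: polymx_id].
    have : q' g1 = 0.
      apply: hS; split=> // g3 ug3 Ag3; rewrite eq' Aq //.
        by rewrite !unitmx_mul unitmx_inv ug1 ug2.
      by rewrite flag_of_mul_eq.
    by rewrite eq' mulmxKV.
  have [] // : Z (flag_of t g).
    apply: h => // F AF.
    have fF := Af F AF.
    by split=> // g' ug' eF q [_]; apply=> //; rewrite -eF.
  by move=> _; apply.
split; first exact: flag_of_flag.
move=> Z [_ [S' [pS' ZS']]] AZ; apply/(ZS' g ug) => p Sp; apply: h.
split=> [|g1 ug1 Ag1]; first exact: pS'.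
by have /(ZS' g1 ug1) := AZ _ Ag1; exact.
Qed.

Lemma irreducible_zclosure A : irreducible t A -> irreducible t (zclosure t A).
Proof.
move=> [[F AF] [Af irrA]]; split; first by exists F; exact: zclosure_sub.
split=> [P []//|C1 C2 c1 c2 h].
have [] : subset_of A C1 \/ subset_of A C2.
- by apply: irrA => // P AP; apply: h; exact: zclosure_sub.
- by move=> ?; left; exact: zclosure_min.
- by move=> ?; right; exact: zclosure_min.
Qed.

Lemma zclosed_cover (T : eqType) (s : seq T) (Cl : T -> seq 'M[C]_n -> Prop) :
  (forall x, x \in s -> zclosed t (Cl x)) ->
  zclosed t (fun F => exists2 x, x \in s & Cl x F).
Proof.
elim: s => [|x s IH] cl.
  have [h1 [S [h2 h3]]] := zclosed_empty; split=> [F []//|].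
  by exists S; split=> // g /h3 <-; split=> // -[].
have [_ [S [pS hS]]] := zclosedU (cl x (mem_head _ _))
   (IH (fun y ys => cl y (mem_behead (s := x :: s) ys))).
split=> [F [y ys]|]; first by have [+ _] := cl y ys; apply.
exists S; split=> // g /hS <-; split.
  by move=> [y]; rewrite inE => /orP[/eqP->|ys] yF; [left|right; exists y].
move=> [xF|[y ys yF]]; first by exists x; rewrite ?mem_head.
by exists y; rewrite // inE ys orbT.
Qed.

Lemma irreducible_cover (T : eqType) (s : seq T) (Cl : T -> seq 'M[C]_n -> Prop) A :
  irreducible t A -> (forall x, x \in s -> zclosed t (Cl x)) ->
  (forall F, A F -> exists2 x, x \in s & Cl x F) ->
  exists2 x, x \in s & subset_of A (Cl x).
Proof.
move=> [[F AF] [Af irrA]]; elim: s => [|x s IH] cl cov.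
  by have [] := cov F AF.
have cl' y : y \in s -> zclosed t (Cl y).
  by move=> ys; apply: cl; rewrite inE ys orbT.
have [] := irrA _ _ (cl x (mem_head _ _)) (zclosed_cover cl').
- move=> P /cov[y]; rewrite inE => /orP[/eqP->|ys] yP; first by left.
  by right; exists y.
- by move=> Ax; exists x => //; exact: mem_head.
- by move=> /(IH cl')[y ys Ay]; exists y; rewrite // inE ys orbT.
Qed.

Definition curve_at (G : 'M[{poly C}]_n) (s : C) : 'M[C]_n :=
  map_mx (horner_eval s) G.

Definition linked A F P := exists G,
  [/\ curve_at G 0 \in unitmx, curve_at G 1 \in unitmx,
      flag_of t (curve_at G 0) = F, flag_of t (curve_at G 1) = P
    & forall s, curve_at G s \in unitmx -> A (flag_of t (curve_at G s))].

Lemma det_curve G s : \det (curve_at G s) = (\det G).[s].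
Proof. exact: (det_map_mx (horner_eval s) G). Qed.

(** Otherwise join a point of [A] outside [C1] to one outside [C2]. An equation failing at each end
    restricts to a nonzero polynomial along the curve; where both polynomials and the determinant
    are nonzero, the curve gives a point of [A] outside both sets. *)
Lemma linked_irreducible A : (exists F, A F) -> (forall F, A F -> is_flag t F) ->
  (forall F P, A F -> A P -> linked A F P) -> irreducible t A.
Proof.
move=> exA Af lnk; split=> //; split=> // C1 C2 [_ [S1 [pS1 e1]]] [_ [S2 [pS2 e2]]] cov.
apply: NNPP => /not_or_and[n1 n2].
have [F nAF] : exists F, ~ (A F -> C1 F) := not_all_ex_not _ _ n1.
have [AF nF] := imply_to_and _ _ nAF.
have [P nAP] : exists P, ~ (A P -> C2 P) := not_all_ex_not _ _ n2.
have [AP nP] := imply_to_and _ _ nAP.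
have [G [u0 u1 eF eP AG]] := lnk _ _ AF AP.
have [f1 nf1] : exists f, ~ (S1 f -> f (curve_at G 0) = 0).
  by apply: not_all_ex_not => h; apply: nF; rewrite -eF; apply/(e1 _ u0).
have [S1f nz1] := imply_to_and _ _ nf1.
have [f2 nf2] : exists f, ~ (S2 f -> f (curve_at G 1) = 0).
  by apply: not_all_ex_not => h; apply: nP; rewrite -eP; apply/(e2 _ u1).
have [S2f nz2] := imply_to_and _ _ nf2.
have [q1 hq1] := polyfun_curve G (pS1 _ S1f).
have [q2 hq2] := polyfun_curve G (pS2 _ S2f).
have nzq (q : {poly C}) s : q.[s] <> 0 -> q != 0.
  by move=> h; apply/eqP => q0; apply: h; rewrite q0 horner0.
have : \det G * (q1 * q2) != 0.
  rewrite !mulf_neq0 //.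
  - by apply: (nzq _ 0); apply/eqP; rewrite -det_curve -unitfE -unitmxE.
  - by apply: (nzq _ 0); rewrite -hq1.
  - by apply: (nzq _ 1); rewrite -hq2.
case/closed_nonrootP => s; rewrite /root !hornerM !mulf_eq0 !negb_or.
move=> /and3P[ds q1s q2s].
have us : curve_at G s \in unitmx by rewrite unitmxE unitfE det_curve.
case: (cov _ (AG s us)) => [/(e1 _ us)/(_ _ S1f)|/(e2 _ us)/(_ _ S2f)] /eqP.
  by rewrite [f1 _]hq1 (negPf q1s).
by rewrite [f2 _]hq2 (negPf q2s).
Qed.

End ZariskiClosed.

(** * Cells *)

Section Cells.
Variables (n' k : nat) (t : seq nat).
Local Notation n := n'.+1.
Local Notation N := (Nmx n k).
Hypothesis kn : (2 * k <= n)%N.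
Hypothesis vt : valid_type n t.
Implicit Types (F P Q : seq 'M[C]_n) (e y : 'rV[C]_n).

Let kltn : (k < n)%N.
Proof. by lia. Qed.

Definition cell (a b : nat -> nat) P := Sp k t P /\
  forall l, (l <= size t)%N -> exists e y, frame N (flag_prev P l) (a l) (b l) e y.

Lemma Sp_step P l : Sp k t P -> (l < size t)%N ->
  (flag_prev P l.+1 *m N <= flag_prev P l)%MS.
Proof. by move=> [_ h] lt; apply: h. Qed.

Lemma Sp_stable P l : Sp k t P -> (l <= size t)%N ->
  (flag_prev P l *m N <= flag_prev P l)%MS.
Proof.
case: l => [|l] sP lt; first by rewrite /= mul0mx sub0mx.
by apply: submx_trans (Sp_step sP lt) (flag_sub1 _ lt); case: sP.
Qed.

Lemma flag_rank_lt P l : is_flag t P -> (l < size t)%N ->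
  (\rank (flag_prev P l) < \rank (flag_prev P l.+1))%N.
Proof.
move=> fP lt; rewrite (flag_rank fP lt) (flag_rank fP (ltnW lt)).
by apply: (flag_dim_lt vt); rewrite ltnSn.
Qed.

(** The inequality in [TopStep] keeps the upper row at least as long as the lower one. *)
Inductive row_step (a b a' b' : nat) : Prop :=
| TopStep of a = a'.+1 & b = b' & (b < a)%N
| BottomStep of a = a' & b = b'.+1
| DoubleStep of a = a'.+1 & b = b'.+1.

Lemma Sp_step_frame P l a b e y : Sp k t P -> (l < size t)%N -> (b <= a)%N ->
  frame N (flag_prev P l) a b e y ->
  exists a' b', [/\ (b' <= a')%N, row_step a b a' b' & exists e y,
   [/\ frame N (flag_prev P l) a b e y, frame N (flag_prev P l.+1) a' b' e y &
    (flag_prev P l.+1 :=: flag_prev P l + (if a == a' then 0 else e *m N ^+ a')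
      + (if b == b' then 0 else y *m N ^+ b'))%MS]].
Proof.
move=> sP lt ba fr; have fP : is_flag t P by case: sP.
have [e1 [y1 [fr1 cases]]] :=
  step_frame ba fr (flag_sub1 fP lt) (Sp_step sP lt) (flag_rank_lt fP lt).
case: cases => [[lt1 eqW]|[b0 eqW]|[b0 eqW]].
- exists a.-1, b; have ea : a = a.-1.+1 by lia.
  split; [lia|by constructor 1|]; exists e1, y1; split=> //.
    apply: (frame_eqmx (eqmx_sym eqW)); apply: frame_drop.
    by rewrite -ea.
  have -> : (a == a.-1) = false by lia.
  by rewrite eqxx; apply: eqmx_trans eqW (eqmx_sym (addsmx0 _ _)).
- exists a, b.-1; have eb : b = b.-1.+1 by lia.
  split; [lia|by constructor 2|]; exists e1, y1; split=> //.
    apply: (frame_eqmx (eqmx_sym eqW)); apply: frame_dropr.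
    by rewrite -eb.
  have -> : (b == b.-1) = false by lia.
  rewrite eqxx; apply: eqmx_trans eqW (adds_eqmx (eqmx_sym (addsmx0 _ _)) (eqmx_refl _)).
- exists a.-1, b.-1; have ea : a = a.-1.+1 by lia.
  have eb : b = b.-1.+1 by lia.
  split; [lia|by constructor 3|]; exists e1, y1; split=> //.
    apply: (frame_eqmx (eqmx_sym eqW)); apply: frame_dropr.
    by rewrite -eb; apply: frame_drop; rewrite -ea.
  have -> : (a == a.-1) = false by lia.
  by have -> : (b == b.-1) = false by lia.
Qed.

(** Starting from the base frame, each step of the flag produces the next shape, so the cells cover
    the variety. *)
Lemma Sp_frames P : Sp k t P -> exists a b : nat -> nat,
  [/\ a 0%N = (n - k)%N, b 0%N = k, cell a b P,
    (forall l, (l <= size t)%N -> (b l <= a l)%N)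
  & forall l, (l < size t)%N -> row_step (a l) (b l) (a l.+1) (b l.+1)].
Proof.
move=> sP.
suff H m : (m <= size t)%N -> exists a b : nat -> nat,
  [/\ a 0%N = (n - k)%N, b 0%N = k,
    forall l, (l <= m)%N -> exists e y, frame N (flag_prev P l) (a l) (b l) e y,
    (forall l, (l <= m)%N -> (b l <= a l)%N)
  & forall l, (l < m)%N -> row_step (a l) (b l) (a l.+1) (b l.+1)].
  by have [a [b [a0 b0 fr le st]]] := H _ (leqnn _); exists a, b; split.
elim: m => [|m IH] lt.
  have [e [y fr]] := frame_base kltn.
  exists (fun _ => n - k)%N, (fun _ => k); split=> // l l0; last by lia.
  by move: l0; rewrite leqn0 => /eqP->; exists e, y.
have [a [b [a0 b0 fr le st]]] := IH (ltnW lt).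
have [e [y frm]] := fr m (leqnn m).
have [a' [b' [ba' step [e' [y' [_ fr' _]]]]]] := Sp_step_frame sP lt (le _ (leqnn m)) frm.
exists (fun l => if l == m.+1 then a' else a l), (fun l => if l == m.+1 then b' else b l).
split=> // l.
- case: eqP => [->|ne] lm; first by exists e', y'.
  by apply: fr; lia.
- by case: eqP => // ne lm; apply: le; lia.
- move=> lm; have -> : (l == m.+1) = false by lia.
  rewrite eqSS; case: eqP => [->//|ne]; apply: st; lia.
Qed.

(** * Irreducibility of a cell *)

Section OneCell.
Variables (a b : nat -> nat).
Hypothesis ba : forall l, (l <= size t)%N -> (b l <= a l)%N.

(** [Sp_step_frame] yields some type at the next level; uniqueness of the Jordan type identifies it
    with the prescribed one. *)
Lemma cell_step P l : cell a b P -> (l < size t)%N ->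
  row_step (a l) (b l) (a l.+1) (b l.+1) /\
  exists e y,
   [/\ frame N (flag_prev P l) (a l) (b l) e y,
       frame N (flag_prev P l.+1) (a l.+1) (b l.+1) e y &
    (flag_prev P l.+1 :=: flag_prev P l + (if a l == a l.+1 then 0 else e *m N ^+ a l.+1)
      + (if b l == b l.+1 then 0 else y *m N ^+ b l.+1))%MS].
Proof.
move=> [sP fr] lt; have [e [y frl]] := fr l (ltnW lt).
have [e' [y' frl']] := fr l.+1 lt.
have [a1 [b1 [ba1 step [e1 [y1 [fr0 fr1 eqW]]]]]] :=
   Sp_step_frame sP lt (ba (ltnW lt)) frl.
have [ea eb] := frame_unique ba1 (ba lt) fr1 frl'.
by rewrite -ea -eb; split=> //; exists e1, y1.
Qed.

Lemma cell_rank P l : cell a b P -> (l <= size t)%N ->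
  (flag_dim t l + (a l + b l) = n)%N.
Proof.
move=> [[fP _] fr] lt; have [e [y frl]] := fr l lt.
by rewrite -(frame_rank frl) (flag_rank fP).
Qed.

Definition move (w : 'M[C]_n) P : seq 'M[C]_n := map (fun U => <<U *m w>>%MS) P.

Lemma move_prev w P l : (l <= size P)%N ->
  flag_prev (move w P) l = <<flag_prev P l *m w>>%MS.
Proof.
case: l => [|l] lt; first by rewrite /= mul0mx genmx0.
by rewrite /= (nth_map 0).
Qed.

Lemma flag_of_move g w : flag_of t (g *m w) = move w (flag_of t g).
Proof.
rewrite /flag_of /move -map_comp; apply: eq_map => d /=.
by apply/genmxP/eqmxP; rewrite mulmxA; apply/eqmx_sym/eqmxMr/genmxE.
Qed.

Lemma move_flag w P : w \in unitmx -> is_flag t P -> is_flag t (move w P).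
Proof.
move=> uw fP; have sP : size P = size t by case: fP.
split; first by rewrite size_map.
split=> l lt.
  change (<<flag_prev (move w P) l.+1>>%MS = flag_prev (move w P) l.+1 /\
    \rank (flag_prev (move w P) l.+1) = flag_dim t l.+1).
  rewrite move_prev ?sP // genmx_id genmxE mxrankMfree ?row_free_unit //.
  by rewrite (flag_rank fP).
change (flag_prev (move w P) l.+1 <= flag_prev (move w P) l.+2)%MS.
rewrite (move_prev _ (l := l.+1)) ?sP; last exact: ltnW.
rewrite move_prev ?sP // !genmxE submxMr //.
exact: (flag_sub1 fP lt).
Qed.

Lemma move_fixed w P i l : is_flag t P -> (l <= i <= size t)%N ->
  fixes N (flag_prev P i) w -> flag_prev (move w P) l = flag_prev P l.
Proof.
move=> fP /andP[li it] fw; have lt := leq_trans li it.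
have sP : size P = size t by case: fP.
rewrite move_prev ?sP // (fixes_sub fw) ?(flag_genmx fP) //.
by apply: (flag_sub fP); rewrite li.
Qed.

(** Nothing moves up to level [i]; above it [w] acts on $V/F_i$ as an automorphism commuting with
    [N], which preserves invariance and Jordan types. *)
Lemma move_cell w P i : cell a b P -> (i <= size t)%N ->
  fixes N (flag_prev P i) w -> cell a b (move w P).
Proof.
move=> [sP fr] it fw; have fP : is_flag t P by case: sP.
have szP : size P = size t by case: fP.
have [uw Uw cw] := fw.
split; first split; first exact: move_flag.
- move=> l lt.
  change (flag_prev (move w P) l.+1 *m N <= flag_prev (move w P) l)%MS.
  have [li|il] := ltnP l i.
    have h1 : (l.+1 <= i <= size t)%N by rewrite li.
    have h2 : (l <= i <= size t)%N by rewrite it ltnW.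
    by rewrite (move_fixed fP h1 fw) (move_fixed fP h2 fw); exact: Sp_step.
  rewrite (move_prev _ (l := l)) ?szP; last exact: ltnW.
  rewrite move_prev ?szP // (eqmxMr _ (genmxE _)) genmxE.
  set W := flag_prev P l.+1.
  have -> : W *m w *m N = W *m N *m w + W *m (w *m N - N *m w).
    by rewrite mulmxBr !mulmxA addrC subrK.
  rewrite addmx_sub //.
    by apply: submxMr; exact: Sp_step.
  apply: submx_trans (submxMl _ _) (submx_trans cw _); rewrite -Uw submxMr //.
  by apply: (flag_sub fP); rewrite il ltnW.
- move=> l lt; have [li|il] := leqP l i.
    by rewrite (move_fixed fP _ fw) ?li //; exact: fr.
  have [e [y frl]] := fr l lt; exists (e *m w), (y *m w).
  rewrite move_prev ?szP //; apply: (frame_eqmx (eqmx_sym (genmxE _))).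
  apply: frame_fixes fw _ frl; first exact: Sp_stable.
  by apply: (flag_sub fP); rewrite ltnW.
Qed.

Lemma moveK w P : w \in unitmx -> is_flag t P -> move (invmx w) (move w P) = P.
Proof.
move=> uw fP; have sP : size P = size t by case: fP.
apply: (@flag_ext _ t); rewrite ?size_map // => l lt.
rewrite !move_prev ?size_map ?sP // -[RHS](flag_genmx fP) //.
apply/genmxP/eqmxP; apply: eqmx_trans (eqmxMr _ (genmxE _)) _.
by rewrite mulmxK.
Qed.

(** Both next subspaces are $F_i$ plus chain ends of frames of the same type, so transporting one
    frame to the other carries one subspace to the other. *)
Lemma cell_transport P Q i : cell a b P -> cell a b Q -> (i < size t)%N ->
  flag_prev P i = flag_prev Q i ->
  exists w, fixes N (flag_prev P i) w /\
    flag_prev (move w P) i.+1 = flag_prev Q i.+1.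
Proof.
move=> cP cQ it eqi.
have [step [e [y [fr _ eP]]]] := cell_step cP it.
have [_ [e' [y' [fr' _ eQ]]]] := cell_step cQ it.
rewrite -eqi in fr' eQ.
have [w [uw Uw cw ew yw]] := frame_transport fr fr'.
exists w; split; first by split.
have [[fP _] _] := cP; have [[fQ _] _] := cQ.
have szP : size P = size t by case: fP.
rewrite move_prev ?szP // -(flag_genmx fQ it).
apply/genmxP/eqmxP; apply: eqmx_trans (eqmx_sym eQ).
apply: eqmx_trans (eqmxMr _ eP) _.
apply: eqmx_trans (addsmxMr _ _ _) _; apply: adds_eqmx.
  apply: eqmx_trans (addsmxMr _ _ _) _; rewrite Uw; apply: adds_eqmx => //.
  case: eqP => ne; first by rewrite mul0mx.
  by rewrite ew //; case: step => *; lia.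
case: eqP => ne; first by rewrite mul0mx.
by rewrite yw //; case: step => *; lia.
Qed.

(** Induction on the number [d] of remaining levels. [P] is moved by some [w] to agree with [Q] one
    level further; the curve from there to [Q] is multiplied by a curve from $w^{-1}$ to the
    identity, which corrects its starting point to [P]. *)
Lemma cell_linked_from d i P Q : (i + d)%N = size t -> cell a b P -> cell a b Q ->
  (forall l, (l <= i)%N -> flag_prev P l = flag_prev Q l) ->
  linked t (fun F => cell a b F /\
     forall l, (l <= i)%N -> flag_prev F l = flag_prev P l) P Q.
Proof.
elim: d i P => [|d IH] i P id cP cQ eqPQ.
  have [[fP _] _] := cP; have [[fQ _] _] := cQ.
  have -> : Q = P.
    by apply: (@flag_ext _ t); [by case: fQ|by case: fP|] => l lt; rewrite eqPQ //; lia.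
  have [g ug eP] := flag_of_surj vt fP.
  have cg s : curve_at (map_mx polyC g) s = g.
    by apply/matrixP => r c; rewrite !mxE /horner_eval hornerC.
  by exists (map_mx polyC g); split; rewrite ?cg // => s; rewrite cg -eP.
have it : (i < size t)%N by lia.
have [w [fw eqi]] := cell_transport cP cQ it (eqPQ i (leqnn i)).
have [uw Uw cw] := fw; have [[fP _] _] := cP.
have cP' := move_cell cP (ltnW it) fw.
have fixl l : (l <= i)%N -> flag_prev (move w P) l = flag_prev P l.
  by move=> li; rewrite (move_fixed fP _ fw) // li ltnW.
have agree l : (l <= i.+1)%N -> flag_prev (move w P) l = flag_prev Q l.
  by rewrite leq_eqVlt => /orP[/eqP->//|li]; rewrite fixl // eqPQ.
have id' : (i.+1 + d)%N = size t by lia.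
have [G [u0 u1 e0 e1 hG]] := IH i.+1 (move w P) id' cP' cQ agree.
(* Fixing $F_i$ pointwise and commuting with [N] modulo $F_i$ are affine conditions, so they hold
   along the whole segment from $w^{-1}$ to the identity. *)
pose W := (1 - 'X) *: map_mx polyC (invmx w) + 'X *: map_mx polyC (1%:M : 'M[C]_n).
pose ws s := (1 - s) *: invmx w + s *: (1%:M : 'M[C]_n).
have cGW s : curve_at (G *m W) s = curve_at G s *m ws s.
  rewrite /curve_at map_mxM; congr (_ *m _).
  apply/matrixP => r c; rewrite !mxE.
  change (((1 - 'X) * (invmx w r c)%:P + 'X * ((r == c)%:R)%:P : {poly C}).[s] =
     (1 - s) * invmx w r c + s * (r == c)%:R).
  by rewrite hornerD !hornerM hornerD hornerN hornerX !hornerC.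
have iw := fixes_inv fw; have [uiw Uiw ciw] := iw.
have fws s : ws s \in unitmx -> fixes N (flag_prev P i) (ws s).
  move=> us; split; first exact: us.
    by rewrite mulmxDr -!scalemxAr Uiw mulmx1 -scalerDl addrNK scale1r.
  have -> : ws s *m N - N *m ws s = (1 - s) *: (invmx w *m N - N *m invmx w).
    rewrite /ws mulmxDl mulmxDr -!scalemxAl -!scalemxAr mul1mx mulmx1 scalerBr.
    by rewrite opprD addrACA subrr addr0.
  exact: scalemx_sub.
have ws0 : ws 0 = invmx w by rewrite /ws subr0 scale1r scale0r addr0.
have ws1 : ws 1 = 1%:M by rewrite /ws subrr scale1r scale0r add0r.
exists (G *m W); split.
- by rewrite cGW ws0 unitmx_mul u0 uiw.
- by rewrite cGW ws1 mulmx1.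
- by rewrite cGW ws0 flag_of_move e0 moveK.
- by rewrite cGW ws1 mulmx1.
- move=> s; rewrite cGW unitmx_mul => /andP[us uws].
  have [cF eF] := hG s us; rewrite flag_of_move.
  have [[fF _] _] := cF.
  have eqF l (li : (l <= i)%N) : flag_prev (flag_of t (curve_at G s)) l = flag_prev P l.
    exact: etrans (eF l (leqW li)) (fixl l li).
  have fF' : fixes N (flag_prev (flag_of t (curve_at G s)) i) (ws s).
    by rewrite (eqF i (leqnn i)); exact: fws.
  split; first exact: (move_cell cF (ltnW it) fF').
  move=> l li; have lit : (l <= i <= size t)%N by rewrite li ltnW.
  by rewrite (move_fixed fF lit fF') eqF.
Qed.

Lemma cell_irreducible : (exists P, cell a b P) -> irreducible t (cell a b).
Proof.
move=> exP; apply: linked_irreducible => //.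
  by move=> F [[]].
move=> P Q cP cQ.
have agree l : (l <= 0)%N -> flag_prev P l = flag_prev Q l.
  by rewrite leqn0 => /eqP->.
have [G [u0 u1 e0 e1 hG]] := cell_linked_from (add0n _) cP cQ agree.
by exists G; split=> // s /hG[].
Qed.

End OneCell.

(** Tails of the two chains of one fixed frame of $V$; a row that does not shrink contributes a
    vector already present. *)
Fixpoint cell_flag (a b : nat -> nat) e y l : 'M[C]_n :=
  if l is l'.+1 then
    <<(cell_flag a b e y l' + e *m N ^+ a l + y *m N ^+ b l)%MS>>%MS
  else 0.

Lemma cell_exists (a b : nat -> nat) : a 0%N = (n - k)%N -> b 0%N = k ->
  (forall l, (l <= size t)%N -> (flag_dim t l + (a l + b l) = n)%N) ->
  (forall l, (l < size t)%N -> row_step (a l) (b l) (a l.+1) (b l.+1)) ->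
  exists P, cell a b P.
Proof.
move=> a0 b0 dims st; have [e [y fr0]] := frame_base kltn.
have fr l : (l <= size t)%N -> frame N (cell_flag a b e y l) (a l) (b l) e y.
  elim: l => [|l IH] lt; first by rewrite a0 b0.
  apply: (frame_eqmx (eqmx_sym (genmxE _))).
  have frl := IH (ltnW lt); have [_ el yl _ _] := frl.
  case: (st l lt) => [ea eb _|ea eb|ea eb].
  - rewrite ea in frl; rewrite -eb; apply: (frame_eqmx _ (frame_drop frl)).
    apply/eqmx_sym/addsmx_idPl.
    exact: submx_trans yl (addsmxSl _ _).
  - rewrite eb in frl; rewrite -ea; apply: (frame_eqmx _ (frame_dropr frl)).
    by apply: adds_eqmx => //; exact/eqmx_sym/addsmx_idPl.
  - rewrite ea eb in frl; apply: frame_dropr; exact: frame_drop.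
pose P := mkseq (fun l => cell_flag a b e y l.+1) (size t).
have Pl l : (l <= size t)%N -> flag_prev P l = cell_flag a b e y l.
  by case: l => [//|l] lt; rewrite /= nth_mkseq.
exists P; split; last by move=> l lt; exists e, y; rewrite Pl //; exact: fr.
split; first split; first by rewrite size_mkseq.
- split=> l lt.
    change (<<flag_prev P l.+1>>%MS = flag_prev P l.+1 /\
      \rank (flag_prev P l.+1) = flag_dim t l.+1).
    rewrite Pl // [LHS]genmx_id; split=> //.
    by apply/eqP; rewrite -(eqn_add2r (a l.+1 + b l.+1)) dims // (frame_rank (fr _ lt)).
  change (flag_prev P l.+1 <= flag_prev P l.+2)%MS.
  rewrite (Pl l.+1 (ltnW lt)) (Pl l.+2 lt).
  rewrite [X in (_ <= X)%MS]/= genmxE -addsmxA; exact: addsmxSl.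
- move=> l lt; change (flag_prev P l.+1 *m N <= flag_prev P l)%MS.
  rewrite (Pl _ lt) (Pl _ (ltnW lt)) (eqmxMr _ (genmxE _)).
  have [sU el yl _ _] := fr l (ltnW lt).
  have pw (v : 'rV[C]_n) m m' : (m <= m'.+1)%N ->
      (v *m N ^+ m <= cell_flag a b e y l)%MS ->
      (v *m N ^+ m' *m N <= cell_flag a b e y l)%MS.
    move=> mm' vm; rewrite -mulmxA -powSr -(subnKC mm') powD mulmxA.
    by apply: submx_trans (submxMr _ vm) (stable_expr _ sU).
  rewrite !(addsmxMr, addsmx_sub) sU /=.
  by apply/andP; split; [apply: pw el|apply: pw yl]; case: (st l lt) => *; lia.
Qed.

(** * Relations between the subspaces of a flag forced by matched steps *)

Section OneCellArcs.
Variables (a b : nat -> nat) (P : seq 'M[C]_n).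
Hypothesis ba : forall l, (l <= size t)%N -> (b l <= a l)%N.
Hypothesis cP : cell a b P.
Local Notation U := (flag_prev P).

Lemma cell_power_sub l c : (l <= size t)%N -> (a l <= c)%N -> (N ^+ c <= U l)%MS.
Proof.
move=> lt ac; have [_ /(_ l lt)[e [y fr]]] := cP.
by rewrite (frame_power_sub c fr) (maxn_idPl (ba lt)).
Qed.

Lemma cell_top_sub l : (l < size t)%N -> b l = b l.+1 ->
  (U l.+1 <= U l + N ^+ a l.+1)%MS.
Proof.
move=> lt eb; have [_ [e [y [_ _ ->]]]] := cell_step ba cP lt.
rewrite eb eqxx addsmx0 addsmx_sub addsmxSl /=; case: eqP => _; first exact: sub0mx.
exact: submx_trans (submxMl _ _) (addsmxSr _ _).
Qed.

Lemma cell_mono l l' : (l <= l' <= size t)%N -> (a l' <= a l)%N /\ (b l' <= b l)%N.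
Proof.
elim: l' => [|l' IH]; first by rewrite leqn0 => /andP[/eqP->].
rewrite leq_eqVlt => /andP[/orP[/eqP->//|ll'] l't].
have [|h1 h2] := IH; first by rewrite -ltnS ll' ltnW.
by have [[] *] := cell_step ba cP l't; lia.
Qed.

(* The row word between levels [i] and [j] is a sequence of matched
   bottom-top pairs, double steps and unmatched tops: [b i - b j] counts the
   pairs and double steps, and the shape difference [a - b] never drops below
   its value at [j]. *)
Lemma cell_arc j i : (i <= j <= size t)%N ->
  (forall l, (i <= l <= j)%N -> (a j + b l <= a l + b j)%N) ->
  (U j *m N ^+ (b i - b j) <= U i + N ^+ (a j + (b i - b j)))%MS.
Proof.
elim/ltn_ind: j i => j IH i /andP[].
rewrite leq_eqVlt => /orP[/eqP-> jt _|].
  by rewrite subnn expr0 mulmx1 addsmxSl.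
case: j IH => // j IH; rewrite ltnS => ij jt high.
have [step _] := cell_step ba cP jt.
have [aij bij] : (a j <= a i)%N /\ (b j <= b i)%N by apply: cell_mono; rewrite ij ltnW.
case: step => [ea eb blta|ea eb|ea eb].
(* A level where $a-b$ is at most its final value means that the last top step is matched in the
   range, by the bottom step following the last such level [m]. *)
- case: (boolP [exists m : 'I_j.+1, (i <= m)%N && (a m + b j.+1 <= a j.+1 + b m)%N]).
    move=> /existsP exm.
    pose p m := [&& (i <= m)%N, (m <= j)%N & (a m + b j.+1 <= a j.+1 + b m)%N].
    have exp : exists m, p m.
      by case: exm => m /andP[im hm]; exists m; rewrite /p im hm -ltnS ltn_ord.
    have pj m : p m -> (m <= j)%N by case/and3P.
    case: (ex_maxnP exp pj) => m /and3P[im mj low] last {exm exp pj}.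
    have mltj : (m < j)%N.
      rewrite ltn_neqAle mj andbT; apply/eqP => emj; move: low; rewrite emj; lia.
    have lastS l : (m < l <= j)%N -> (a j.+1 + b l < a l + b j.+1)%N.
      move=> /andP[ml lj]; rewrite ltnNge; apply/negP => hl.
      have : p l by rewrite /p lj hl andbT (leq_trans im) // ltnW.
      by move/last; lia.
    have hS := lastS m.+1; rewrite ltnSn mltj in hS; have {}hS := hS isT.
    have [stm _] := cell_step ba cP (leq_trans mltj (ltnW jt)).
    have [eam ebm] : a m = a m.+1 /\ b m = (b m.+1).+1.
      by case: stm => *; lia.
    have [aSj bSj] : (a j <= a m.+1)%N /\ (b j <= b m.+1)%N.
      by apply: cell_mono; rewrite mltj ltnW.
    have [aim bim] : (a m <= a i)%N /\ (b m <= b i)%N.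
      by apply: cell_mono; rewrite im (leq_trans mj) // ltnW.
    pose d1 := (b m.+1 - b j)%N.
    have A1 : (U j *m N ^+ d1 <= U m.+1)%MS.
      apply: submx_trans (IH j (ltnSn j) m.+1 _ _) _.
      + by rewrite mltj ltnW.
      + by move=> l hl; have := lastS l hl; lia.
      + rewrite addsmx_sub submx_refl andTb; apply: cell_power_sub; last by lia.
        by rewrite (leq_trans mltj) // ltnW.
    have mt : (m < size t)%N by rewrite (leq_trans mltj) // ltnW.
    (* Since [N] maps level [m.+1] into level [m], one more power of [N] extends the inner relation
       over the enclosing matched pair. *)
    have A2 : (U j.+1 *m N ^+ d1.+1 <= U m)%MS.
      apply: submx_trans (submxMr _ (cell_top_sub jt eb)) _.
      rewrite addsmxMr addsmx_sub; apply/andP; split.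
        rewrite powSr mulmxA; apply: submx_trans (submxMr _ A1) _.
        by apply: Sp_step mt; case: cP.
      rewrite -powD; apply: cell_power_sub; first exact: ltnW.
      by rewrite /d1; lia.
    have A3 : (U m *m N ^+ (b i - b m) <= U i + N ^+ (a m + (b i - b m)))%MS.
      apply: IH; [by []|by rewrite im ltnW|] => l /andP[il lm].
      have := high l; rewrite il => /(_ _); have : (l <= j.+1)%N by lia.
      by move=> -> /(_ isT); lia.
    have -> : (b i - b j.+1 = d1.+1 + (b i - b m))%N by rewrite /d1; lia.
    rewrite powD mulmxA; apply: submx_trans (submxMr _ A2) (submx_trans A3 _).
    by have -> : (a j.+1 + (d1.+1 + (b i - b m)) = a m + (b i - b m))%N by rewrite /d1; lia.
  (* The last top step is now unmatched: it adds only vectors in the image of a power of [N], which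
     the second summand absorbs. *)
  rewrite negb_exists => /forallP nom.
  have nomS l : (i <= l <= j)%N -> (a j.+1 + b l < a l + b j.+1)%N.
    move=> /andP[il lj]; have ltl : (l < j.+1)%N by [].
    by have := nom (Ordinal ltl); rewrite /= il /= -ltnNge.
  have A1 : (U j *m N ^+ (b i - b j) <= U i + N ^+ (a j + (b i - b j)))%MS.
    apply: IH; [by []|by rewrite ij ltnW|] => l hl.
    by have := nomS l hl; lia.
  rewrite -eb; apply: submx_trans (submxMr _ (cell_top_sub jt eb)) _.
  rewrite addsmxMr addsmx_sub -powD addsmxSr andbT.
  apply: submx_trans A1 _; rewrite addsmx_sub addsmxSl /= ea addSn powS.
  exact: submx_trans (submxMl _ _) (addsmxSr _ _).
(* A bottom step raises $a-b$, so the difference at [j] would lie below its final value. *)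
- have := high j; rewrite ij leqnSn => /(_ isT); lia.
- have A1 : (U j *m N ^+ (b i - b j) <= U i + N ^+ (a j + (b i - b j)))%MS.
    apply: IH; [by []|by rewrite ij ltnW|] => l /andP[il lj].
    have := high l; rewrite il (leq_trans lj) // => /(_ isT); lia.
  have -> : (b i - b j.+1 = (b i - b j).+1)%N by lia.
  rewrite powS mulmxA; have sP : Sp k t P by case: cP.
  apply: submx_trans (submxMr _ (Sp_step sP jt)) (submx_trans A1 _).
  by have -> : (a j + (b i - b j) = a j.+1 + (b i - b j).+1)%N by lia.
Qed.

(* A top step is either matched with a bottom step or unmatched. *)
Lemma cell_top_match j : (j < size t)%N -> a j = (a j.+1).+1 -> b j = b j.+1 ->
  exists m, [/\ (m <= j)%N,
    (forall l, (m <= l <= j.+1)%N -> (a j.+1 + b l <= a l + b j.+1)%N) &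
    m = 0%N \/ (a j.+1 + b m = a m + b j.+1)%N].
Proof.
move=> jt ea eb.
case: (boolP [exists m : 'I_j.+1, (a m + b j.+1 <= a j.+1 + b m)%N]).
  move=> /existsP exm.
  pose p m := (m <= j)%N && (a m + b j.+1 <= a j.+1 + b m)%N.
  have exp : exists m, p m.
    by case: exm => m hm; exists m; rewrite /p hm -ltnS ltn_ord.
  have pj m : p m -> (m <= j)%N by case/andP.
  case: (ex_maxnP exp pj) => m /andP[mj low] last {exm exp pj}.
  have mltj : (m < j)%N.
    rewrite ltn_neqAle mj andbT; apply/eqP => emj; move: low; rewrite emj; lia.
  have lastS l : (m < l <= j)%N -> (a j.+1 + b l < a l + b j.+1)%N.
    move=> /andP[ml lj]; rewrite ltnNge; apply/negP => hl.
    have : p l by rewrite /p lj hl.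
    by move/last; lia.
  have hS := lastS m.+1; rewrite ltnSn mltj in hS; have {}hS := hS isT.
  have mt : (m < size t)%N by apply: leq_trans mltj (ltnW jt).
  have [stm _] := cell_step ba cP mt.
  have eqm : (a j.+1 + b m = a m + b j.+1)%N by case: stm => *; lia.
  exists m; split=> //; last by right.
  move=> l /andP[ml lj]; have [->|lm] := eqVneq l m; first by lia.
  have [->|lj'] := eqVneq l j.+1; first by lia.
  by have := lastS l; lia.
rewrite negb_exists => /forallP nom.
exists 0%N; split=> //; last by left.
move=> l /andP[_]; rewrite leq_eqVlt => /orP[/eqP->|lj]; first by lia.
by have := nom (Ordinal lj); rewrite /= -ltnNge; lia.
Qed.

End OneCellArcs.

Lemma zclosure_map_flag A l l' (M : 'M[C]_n) F : (l <= size t)%N -> (l' <= size t)%N ->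
  (forall P, A P -> is_flag t P /\ (flag_prev P l *m M <= flag_prev P l')%MS) ->
  zclosure t A F -> (flag_prev F l *m M <= flag_prev F l')%MS.
Proof.
by move=> lt lt' h [_ /(_ _ (zclosed_map_flag vt M lt lt'))] [].
Qed.

Lemma zclosure_map_sub A l (M W : 'M[C]_n) F : (l <= size t)%N ->
  (forall P, A P -> is_flag t P /\ (flag_prev P l *m M <= W)%MS) ->
  zclosure t A F -> (flag_prev F l *m M <= W)%MS.
Proof.
by move=> lt h [_ /(_ _ (zclosed_map_sub vt M W lt))] [].
Qed.

Lemma rank_power c : \rank (N ^+ c) = ((n - k - c) + (k - c))%N.
Proof.
have [e [y fr]] := frame_base kltn.
by have := rank_powers c fr; rewrite addsmx0 mxrank0.
Qed.

(** At a bottom step the [y]-chain can be modified by the [e]-chain without changing the cell or the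
    earlier subspaces. If the next subspace contained the new one, it would contain the last vector
    of the [e]-chain, which is still nonzero modulo it. *)
Lemma cell_bottom_move (a b : nat -> nat) P j :
  (forall l, (l <= size t)%N -> (b l <= a l)%N) ->
  cell a b P -> (j < size t)%N -> a j = a j.+1 -> b j = (b j.+1).+1 ->
  exists Q, [/\ cell a b Q, (forall l, (l <= j)%N -> flag_prev Q l = flag_prev P l)
    & ~~ (flag_prev Q j.+1 <= flag_prev P j.+1)%MS].
Proof.
move=> ba cP jt ea eb.
have [_ [e [y [fr fr' eqW]]]] := cell_step ba cP jt.
have fr1 := frame_change 1 (ba j (ltnW jt)) fr.
set y1 := y + _ in fr1.
have [w [uw Uw cw ew yw]] := frame_transport fr fr1.
have fw : fixes N (flag_prev P j) w by split.
have [[fP _] _] := cP; have szP : size P = size t by case: fP.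
exists (move w P); split; first exact: (move_cell cP (ltnW jt) fw).
  by move=> l lj; rewrite (move_fixed fP _ fw) // lj ltnW.
rewrite move_prev ?szP // genmxE (eqmxMr w eqW).
rewrite ea eqxx eb; have -> : (b j.+1).+1 == b j.+1 = false by lia.
apply/negP => sub.
have : (y *m N ^+ b j.+1 *m w <= flag_prev P j.+1)%MS.
  by apply: submx_trans (submxMr _ (addsmxSr _ _)) sub.
rewrite yw; last by rewrite eb.
rewrite /y1 mulmxDl scale1r -mulmxA -powD => sub1.
have [_ _ s3 _ s5] := fr'.
have : (e *m N ^+ (a j - b j + b j.+1) <= flag_prev P j.+1)%MS.
  by rewrite -(addKr (y *m N ^+ b j.+1) (e *m _)) addmx_sub ?eqmx_opp.
rewrite -actXn => sub2.
have /s5/andP[+ _] : ((act N e 'X^(a j - b j + b j.+1) + act N y 0)%R <= flag_prev P j.+1)%MS.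
  by rewrite /act (rmorph0 (horner_mx N)) mulmx0 addr0.
have nz : 'X^(a j - b j + b j.+1) != 0 :> {poly C} by rewrite monic_neq0 ?monicXn.
move/(dvdp_leq nz); rewrite !size_polyXn; have := ba j (ltnW jt); lia.
Qed.

(** * Distinct cells are not contained in each other's closures *)

Section Separation.
Variables a b a' b' : nat -> nat.
Hypothesis ba : forall l, (l <= size t)%N -> (b l <= a l)%N.
Hypothesis ba' : forall l, (l <= size t)%N -> (b' l <= a' l)%N.
Hypothesis cell_cell' : subset_of (cell a b) (zclosure t (cell a' b')).

(** Suppose the first cell has a bottom step there. Two of its points agree up to level [j] and
    differ next; the arc relation of the second cell is closed, so it holds at both and traps the
    sum of the two next subspaces in a subspace of too small dimension. *)
Lemma cell_sub_top P P' j : cell a b P -> cell a' b' P' ->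
  a' 0%N = (n - k)%N -> b' 0%N = k -> (j < size t)%N ->
  a' j = (a' j.+1).+1 -> a j = (a j.+1).+1.
Proof.
move=> cP cP' a0 b0 jt ea'.
have jt' := ltnW jt.
have [step _] := cell_step ba cP jt; have [step' _] := cell_step ba' cP' jt.
have := cell_rank cP jt'; have := cell_rank cP jt.
have := cell_rank cP' jt'; have := cell_rank cP' jt => r1' r2' r1 r2.
case: step' => [_ eb' _|ea1 _|_ eb']; first last.
- by case: step => *; lia.
- by lia.
case: step => // ea eb; exfalso.
have [Q [cQ eqQ nsub]] := cell_bottom_move ba cP jt ea eb.
set V := (flag_prev P j.+1 + flag_prev Q j.+1)%MS.
have [[fP _] _] := cP.
have rV : (flag_dim t j.+1 < \rank V)%N.
  rewrite -(flag_rank fP jt); apply: rank_ltmx.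
  rewrite /ltmx addsmxSl addsmx_sub submx_refl andTb.
  by [].
(* A subspace sent into [W] by $N^c$ has dimension at most that of [W] plus $2c$, whereas [V] is
   larger than level [j.+1] of the flag. *)
have bound c (W : 'M[C]_n) : (flag_prev P j.+1 *m N ^+ c <= W)%MS ->
    (flag_prev Q j.+1 *m N ^+ c <= W)%MS ->
    (\rank W + c.*2 <= flag_dim t j.+1)%N -> False.
  move=> hP hQ hr; have [e [y fr]] := frame_base kltn.
  have := rank_le_kernel V c fr.
  have := mxrankS (_ : (V *m N ^+ c <= W)%MS).
  rewrite addsmxMr addsmx_sub hP hQ => /(_ isT).
  by move: rV hr; set r3 := \rank _; set r4 := \rank _; set r5 := \rank _; lia.
have [m [mj high matched]] := cell_top_match ba' cP' jt ea' eb'.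
have mt : (m <= size t)%N by exact: leq_trans mj jt'.
have mj1 : (m <= j.+1 <= size t)%N by rewrite leqW.
have [aj bj] := cell_mono ba' cP' mj1.
have cell'_flag G : cell a' b' G -> is_flag t G by case=> [[]].
(* In the unmatched case [W] is the image of a power of [N]; in the matched case it is level [m],
   common to both points. *)
case: matched => [m0|eqm].
- have arc F : cell a b F -> (flag_prev F j.+1 *m N ^+ (b' m - b' j.+1) <=
      N ^+ (a' j.+1 + (b' m - b' j.+1)))%MS.
    move=> /cell_cell'; apply: (zclosure_map_sub jt) => G cG.
    split; first exact: cell'_flag.
    by have := cell_arc ba' cG mj1 high; rewrite m0 adds0mx.
  apply: (bound _ _ (arc P cP) (arc Q cQ)).
  rewrite rank_power; have := high 0%N; rewrite m0 a0 b0 => /(_ isT).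
  by rewrite m0 b0 in bj; have := ba' jt; move: r1'; lia.
- have arc F : cell a b F ->
      (flag_prev F j.+1 *m N ^+ (b' m - b' j.+1) <= flag_prev F m)%MS.
    move=> /cell_cell'; apply: (zclosure_map_flag jt mt) => G cG.
    split; first exact: cell'_flag.
    apply: submx_trans (cell_arc ba' cG mj1 high) _.
    rewrite addsmx_sub submx_refl andTb; apply: (cell_power_sub ba' cG mt).
    by lia.
  have arcQ := arc Q cQ; rewrite (eqQ m mj) in arcQ.
  apply: (bound _ _ (arc P cP) arcQ).
  by rewrite (flag_rank fP mt); have := cell_rank cP' mt; lia.
Qed.

(** The first top row loses a box whenever the second does. Counting from level 0, where both have
    $n-k$ boxes, gives $a \le a'$; counting back from the last level, where both are empty, gives
    $a' \le a$. *)
Lemma cell_sub_eq P P' : cell a b P -> cell a' b' P' ->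
  a 0%N = (n - k)%N -> a' 0%N = (n - k)%N -> b' 0%N = k ->
  forall l, (l <= size t)%N -> a l = a' l /\ b l = b' l.
Proof.
move=> cP cP' a0 a0' b0'.
have le l : (l <= size t)%N -> (a l <= a' l)%N.
  elim: l => [|l IH] lt; first by rewrite a0 a0'.
  have := IH (ltnW lt); have top := cell_sub_top cP cP' a0' b0' lt.
  have [step _] := cell_step ba cP lt; have [step' _] := cell_step ba' cP' lt.
  by case: step => *; case: step' => *; lia.
have ge d : (d <= size t)%N -> (a' (size t - d) <= a (size t - d))%N.
  elim: d => [|d IH] dt.
    have := cell_rank cP' (leqnn _); rewrite subn0 (flag_dim_last vt); lia.
  have lt : (size t - d.+1 < size t)%N by lia.
  have := IH (ltnW dt); have top := cell_sub_top cP cP' a0' b0' lt.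
  have [step _] := cell_step ba cP lt; have [step' _] := cell_step ba' cP' lt.
  have -> : (size t - d = (size t - d.+1).+1)%N by lia.
  by case: step => *; case: step' => *; lia.
move=> l lt; have := le l lt; have := ge (size t - l)%N (leq_subr _ _).
have -> : (size t - (size t - l) = l)%N by lia.
by have := cell_rank cP lt; have := cell_rank cP' lt; lia.
Qed.

End Separation.

Lemma zclosure_Sp (a b : nat -> nat) F : zclosure t (cell a b) F -> Sp k t F.
Proof.
move=> cF; split; first by case: cF.
move=> l lt; apply: (zclosure_map_flag (l := l.+1) (l' := l) _ _ _ cF) => //.
  exact: ltnW.
move=> P [sP _]; split; first by case: sP.
exact: Sp_step.
Qed.

End Cells.

(** * Tableaux as shape sequences *)

Definition desc : rel nat := fun x y => (y < x)%N.

(** The entries above [i] form an initial segment of a decreasing row. This turns the column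
    condition of a tableau into an inequality of counts. *)
Lemma desc_count s c i : sorted desc s -> (c < size s)%N ->
  (i < nth 0 s c)%N = (c < count (fun x => i < x)%N s)%N.
Proof.
elim: s c => [|x s IH] c //= srt; have srt' : sorted desc s by apply: path_sorted srt.
have [ix|xi] := ltnP i x; first by case: c => // c; rewrite ltnS => /(IH _ srt') ->.
have small y : y \in s -> (i < y)%N = false.
  have tr : transitive desc by move=> u v w; rewrite /desc => h1 h2; apply: ltn_trans h2 h1.
  move: srt; rewrite (path_sortedE tr) => /andP[/allP h _] /h; rewrite /desc; lia.
have -> : count (fun y => i < y)%N s = 0%N.
  by apply/eqP; rewrite eqn0Ngt -has_count; apply/hasPn => y /small->.
case: c => [|c] lt /=; first by lia.
by rewrite small // mem_nth.
Qed.

Section Tableaux.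
Variables (n k : nat) (t : seq nat).
Hypothesis kn : (2 * k <= n)%N.
Hypothesis vt : valid_type n t.
Local Notation fd := (flag_dim t).

Lemma filter_type l : (l < size t)%N -> [seq u <- t | u < fd l.+1]%N = take l t.
Proof.
move=> lt; rewrite -[X in filter _ X](cat_take_drop l t) filter_cat.
have -> : [seq u <- take l t | u < fd l.+1]%N = take l t.
  apply/all_filterP/(all_nthP 0%N) => i; rewrite (size_takel (ltnW lt)) => il.
  rewrite nth_take //; apply: (flag_dim_lt vt (l := i.+1)).
  by rewrite ltnS il.
have -> : [seq u <- drop l t | u < fd l.+1]%N = [::].
  apply/eqP; rewrite -(negbK (_ == _)) -has_filter -all_predC.
  apply/(all_nthP 0%N) => i; rewrite size_drop => il.
  rewrite nth_drop /= -leqNgt.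
  by apply: (flag_dim_le vt (l := l.+1) (l' := (l + i).+1)); rewrite ltnS leq_addr /=; lia.
by rewrite cats0.
Qed.

Lemma tmult_dim l : (l < size t)%N -> tmult t (fd l.+1) = (fd l.+1 - fd l)%N.
Proof.
move=> lt; rewrite /tmult flag_dim_mem // filter_type //; congr (_ - _)%N.
case: l lt => [|l] lt; first by rewrite take0.
by rewrite -nth_last (size_takel (ltnW lt)) /= nth_take.
Qed.

Lemma dim_succ_cmp l x : (l < size t)%N -> x \in t ->
  (fd l < x)%N = ((fd l.+1 < x) + (x == fd l.+1))%N :> nat.
Proof.
move=> lt /(mem_flag_dim (t := t))[l' /andP[l0 l't] ->].
have step : (fd l < fd l.+1)%N by apply: (flag_dim_lt vt); rewrite ltnSn.
have [h|h|->] := ltngtP l' l.+1; last by rewrite eqxx step ltnn.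
  have le1 : (fd l' <= fd l)%N by apply: (flag_dim_le vt); rewrite -ltnS h ltnW.
  rewrite (ltn_eqF (leq_ltn_trans le1 step)).
  by rewrite !ltnNge le1 (leq_trans le1 (ltnW step)).
have lt1 : (fd l.+1 < fd l')%N by apply: (flag_dim_lt vt); rewrite h.
rewrite (gtn_eqF lt1).
by rewrite lt1 (ltn_trans step lt1).
Qed.

Lemma count_succ s l : {subset s <= t} -> (l < size t)%N ->
  count (fun x => fd l < x)%N s =
  (count (fun x => fd l.+1 < x)%N s + count_mem (fd l.+1) s)%N.
Proof.
move=> st lt; elim: s st => // x s IH st /=.
rewrite IH; last by move=> y ys; apply: st; rewrite inE ys orbT.
by rewrite (dim_succ_cmp lt (st x (mem_head _ _))) addnACA.
Qed.

Definition top_count (S : tableau) l := count (fun x => fd l < x)%N S.1.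
Definition bottom_count (S : tableau) l := count (fun x => fd l < x)%N S.2.

Lemma desc_uniq s : sorted desc s -> uniq s.
Proof.
apply: sorted_uniq => [u v w|u]; last exact: ltnn.
by rewrite /desc => h1 h2; apply: ltn_trans h2 h1.
Qed.

Lemma row_count0 s : {subset s <= t} -> count (fun x => fd 0 < x)%N s = size s.
Proof.
move=> st; apply/eqP; rewrite -all_count; apply/allP => x /st.
move=> /(mem_flag_dim (t := t))[l /andP[l0 lt] ->].
by apply: (flag_dim_lt vt); rewrite l0.
Qed.

Lemma row_count_last s : {subset s <= t} ->
  count (fun x => fd (size t) < x)%N s = 0%N.
Proof.
move=> st; apply/eqP; rewrite eqn0Ngt -has_count; apply/hasPn => x /st.
move=> /(mem_flag_dim (t := t))[l /andP[l0 lt] ->].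
by rewrite -leqNgt; apply: (flag_dim_le vt); rewrite lt leqnn.
Qed.

Section Standard.
Variable S : tableau.
Hypothesis stS : standard_tableau n k t S.

Lemma standard_sub : {subset S.1 <= t} /\ {subset S.2 <= t}.
Proof.
have [_ [_ [ty _]]] := stS.
have sub x : x \in S.1 ++ S.2 -> x \in t.
  rewrite -has_pred1 has_count ty /tmult; case: ifP => //.
by split=> x xS; apply: sub; rewrite mem_cat xS ?orbT.
Qed.

Lemma standard_le l : (bottom_count S l <= top_count S l)%N.
Proof.
have [s1 [s2 [_ [[d1 d2] std]]]] := stS.
case eb: (bottom_count S l) => [//|c].
have ck : (c < size S.2)%N.
  by apply: leq_trans (count_size (fun x => fd l < x)%N S.2); rewrite -/(bottom_count S l) eb.
have c1 : (c < size S.1)%N by lia.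
rewrite /top_count -(desc_count _ d1 c1).
apply: leq_trans (std c _); last by rewrite -s2.
by rewrite (desc_count _ d2 ck) -/(bottom_count S l) eb.
Qed.

Lemma standard_top0 : top_count S 0 = (n - k)%N.
Proof. by have [<- _] := stS; rewrite /top_count row_count0 //; case: standard_sub. Qed.

Lemma standard_bottom0 : bottom_count S 0 = k.
Proof. by have [_ [<- _]] := stS; rewrite /bottom_count row_count0 //; case: standard_sub. Qed.

Lemma standard_drop l : (l < size t)%N ->
  [/\ top_count S l = (top_count S l.+1 + (fd l.+1 \in S.1))%N,
      bottom_count S l = (bottom_count S l.+1 + (fd l.+1 \in S.2))%N &
      ((fd l.+1 \in S.1) + (fd l.+1 \in S.2) = fd l.+1 - fd l)%N].
Proof.
move=> lt; have [sub1 sub2] := standard_sub.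
have [_ [_ [ty [[d1 d2] _]]]] := stS.
rewrite /top_count /bottom_count (count_succ sub1 lt) (count_succ sub2 lt).
rewrite !(count_uniq_mem _ (desc_uniq d1)) !(count_uniq_mem _ (desc_uniq d2)).
split=> //; rewrite -tmult_dim // -ty count_cat.
by rewrite (count_uniq_mem _ (desc_uniq d1)) (count_uniq_mem _ (desc_uniq d2)).
Qed.

Lemma standard_dim l : (l <= size t)%N -> (fd l + (top_count S l + bottom_count S l) = n)%N.
Proof.
elim: l => [|l IH] lt; first by rewrite standard_top0 standard_bottom0 /flag_dim /=; lia.
have := IH (ltnW lt); have [] := standard_drop lt.
have : (fd l < fd l.+1)%N by apply: (flag_dim_lt vt); rewrite ltnSn.
by move: (fd l.+1 \in S.1) (fd l.+1 \in S.2) => [] []; lia.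
Qed.

Lemma standard_step l : (l < size t)%N ->
  row_step (top_count S l) (bottom_count S l) (top_count S l.+1) (bottom_count S l.+1).
Proof.
move=> lt; have [] := standard_drop lt; have := standard_le l.+1.
have : (fd l < fd l.+1)%N by apply: (flag_dim_lt vt); rewrite ltnSn.
move: (fd l.+1 \in S.1) (fd l.+1 \in S.2) => [] [] /=; rewrite ?addn1 ?addn0.
- by constructor 3.
- by constructor 1; lia.
- by constructor 2.
- by lia.
Qed.

Lemma standard_gap l : (l < size t)%N -> (fd l.+1 <= (fd l).+2)%N.
Proof.
by move=> lt; have [_ _] := standard_drop lt; move: (_ \in _) (_ \in _) => [] []; lia.
Qed.

End Standard.

Lemma standard_inj S S' : standard_tableau n k t S -> standard_tableau n k t S' ->
  (forall l, (l <= size t)%N ->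
     top_count S l = top_count S' l /\ bottom_count S l = bottom_count S' l) ->
  S = S'.
Proof.
move=> stS stS' eqc.
have [sub1 sub2] := standard_sub stS; have [sub1' sub2'] := standard_sub stS'.
have [_ [_ [_ [[d1 d2] _]]]] := stS; have [_ [_ [_ [[d1' d2'] _]]]] := stS'.
have tr : transitive desc by move=> u v w; rewrite /desc => h1 h2; apply: ltn_trans h2 h1.
have irr : irreflexive desc by move=> u; exact: ltnn.
have mem x : x \in t -> (x \in S.1) = (x \in S'.1) /\ (x \in S.2) = (x \in S'.2).
  move=> /(mem_flag_dim (t := t))[[//|l] /= lt ->].
  have [h1 h2 _] := standard_drop stS lt; have [h1' h2' _] := standard_drop stS' lt.
  have [] := eqc l (ltnW lt); have [] := eqc l.+1 lt; rewrite h1 h2 h1' h2'.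
  move=> -> -> /addnI + /addnI.
  by move: (_ \in S.1) (_ \in S.2) (_ \in S'.1) (_ \in S'.2) => [] [] [] [].
have e1 : S.1 = S'.1.
  apply: (irr_sorted_eq tr irr d1 d1') => x.
  by apply/idP/idP => h; [have [<-] := mem x (sub1 x h)|have [->] := mem x (sub1' x h)].
have e2 : S.2 = S'.2.
  apply: (irr_sorted_eq tr irr d2 d2') => x.
  by apply/idP/idP => h; [have [_ <-] := mem x (sub2 x h)|have [_ ->] := mem x (sub2' x h)].
by rewrite (surjective_pairing S) e1 e2 -surjective_pairing.
Qed.

Lemma type_sorted : sorted ltn t.
Proof. by have [_ [+ _]] := vt; exact: path_sorted. Qed.

Lemma desc_trans : transitive desc.
Proof. by move=> u v w; rewrite /desc => h1 h2; apply: ltn_trans h2 h1. Qed.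

Lemma desc_row_filter s : sorted desc s -> {subset s <= t} ->
  s = rev [seq x <- t | x \in s].
Proof.
move=> ds sub; apply: (irr_sorted_eq desc_trans (fun u => ltnn u)) => // [|x].
  by rewrite rev_sorted; apply: sorted_filter type_sorted; exact: ltn_trans.
by rewrite mem_rev mem_filter; case xs: (x \in s) => //=; rewrite sub.
Qed.

(** Each row is the reversal of a sublist of [t], hence is given by a mask. Finiteness lets an
    irreducible set be absorbed by the closure of a single cell. *)
Lemma standard_finite : exists s : seq tableau,
  forall S, standard_tableau n k t S -> S \in s.
Proof.
pose rows := [seq rev (mask (val m) t) | m <- enum {: (size t).-tuple bool}].
have rowsP (s : seq nat) : sorted desc s -> {subset s <= t} -> s \in rows.
  move=> ds sub; apply/mapP.
  have sz : size [seq x \in s | x <- t] == size t by rewrite size_map.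
  by exists (Tuple sz); rewrite ?mem_enum //= -filter_mask -desc_row_filter.
exists [seq (r1, r2) | r1 <- rows, r2 <- rows] => S stS.
have [sub1 sub2] := standard_sub stS; have [_ [_ [_ [[d1 d2] _]]]] := stS.
by rewrite (surjective_pairing S); apply: allpairs_f; exact: rowsP.
Qed.

(** * The standard tableau of a chain of shapes *)

Section FromShapes.
Variables a b : nat -> nat.
Hypothesis ba : forall l, (l <= size t)%N -> (b l <= a l)%N.
Hypothesis a0 : a 0%N = (n - k)%N.
Hypothesis b0 : b 0%N = k.
Hypothesis dims : forall l, (l <= size t)%N -> (fd l + (a l + b l) = n)%N.
Hypothesis step : forall l, (l < size t)%N -> row_step (a l) (b l) (a l.+1) (b l.+1).

Definition row_of (c : nat -> nat) : seq nat :=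
  rev [seq fd l.+1 | l <- iota 0 (size t) & (c l.+1 < c l)%N].

Lemma row_of_desc c : sorted desc (row_of c).
Proof.
rewrite rev_sorted sorted_map.
apply: (@sub_in_sorted _ (fun l => l < size t)%N ltn) => [x y xt yt xy||].
- by apply: (flag_dim_lt vt); rewrite ltnS (xy : (x < y)%N).
- by apply/allP => x; rewrite mem_filter mem_iota => /andP[_ /andP[_]].
- by apply: sorted_filter (iota_ltn_sorted _ _); exact: ltn_trans.
Qed.

Lemma mem_row_of c l : (l < size t)%N -> (fd l.+1 \in row_of c) = (c l.+1 < c l)%N.
Proof.
move=> lt; rewrite mem_rev; apply/mapP/idP => [[l']|h].
  rewrite mem_filter mem_iota add0n => /andP[h /andP[_ l't]] eqd.
  suff -> : l = l' by [].
  case: (ltngtP l l') => // ll'; exfalso.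
    by have := flag_dim_lt vt (_ : (l.+1 < l'.+1 <= size t)%N); rewrite eqd ltnn ltnS ll' l't => /(_ isT).
  by have := flag_dim_lt vt (_ : (l'.+1 < l.+1 <= size t)%N); rewrite eqd ltnn ltnS ll' lt => /(_ isT).
by exists l => //; rewrite mem_filter h mem_iota.
Qed.

Lemma row_of_sub c : {subset row_of c <= t}.
Proof.
move=> x; rewrite mem_rev => /mapP[l]; rewrite mem_filter mem_iota add0n.
by move=> /andP[_ /andP[_ lt]] ->; rewrite flag_dim_mem.
Qed.

Lemma row_of_count c l : c (size t) = 0%N ->
  (forall l, (l < size t)%N -> (c l.+1 <= c l <= (c l.+1).+1)%N) ->
  (l <= size t)%N -> count (fun x => fd l < x)%N (row_of c) = c l.
Proof.
move=> clast cstep lt; rewrite -(subKn lt); move: (size t - l)%N (leq_subr l (size t)).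
elim=> [|d IH] dt; first by rewrite subn0 clast row_count_last //; exact: row_of_sub.
have lt' : (size t - d.+1 < size t)%N by lia.
rewrite (count_succ (@row_of_sub c) lt') -subSn // subSS IH; last exact: ltnW.
rewrite (count_uniq_mem _ (desc_uniq (row_of_desc c))).
have -> : (size t - d = (size t - d.+1).+1)%N by lia.
rewrite mem_row_of //; have /andP[] := cstep _ lt'.
by case: ltnP => /= *; lia.
Qed.

Definition tableau_of : tableau := (row_of a, row_of b).

Lemma shapes_last : a (size t) = 0%N /\ b (size t) = 0%N.
Proof. by have := dims (leqnn _); rewrite (flag_dim_last vt); lia. Qed.

Lemma tableau_of_count l : (l <= size t)%N ->
  top_count tableau_of l = a l /\ bottom_count tableau_of l = b l.
Proof.
have [al bl] := shapes_last.
by move=> lt; split; apply: row_of_count => // l' /step; case=> *; lia.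
Qed.

Lemma tableau_of_standard : standard_tableau n k t tableau_of.
Proof.
have [cA cB] := tableau_of_count (leq0n _).
have sA : size (row_of a) = (n - k)%N.
  by rewrite -a0 -cA /top_count row_count0 //; exact: row_of_sub.
have sB : size (row_of b) = k.
  by rewrite -b0 -cB /bottom_count row_count0 //; exact: row_of_sub.
split=> //; split=> //; split; last split.
- move=> v; rewrite count_cat !(count_uniq_mem _ (desc_uniq (row_of_desc _))).
  have [tv|vt'] := boolP (v \in t).
    have [[//|l] /= lt ->] := mem_flag_dim tv.
    rewrite tmult_dim // !mem_row_of //; have := dims lt; have := dims (ltnW lt).
    by case: (step lt) => -> ->; rewrite ?ltnn ?ltnSn /=; lia.
  rewrite /tmult (negPf vt').
  have no c : (v \in row_of c) = false by apply: contraNF vt' => /row_of_sub.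
  by rewrite !no.
- by split; exact: row_of_desc.
(* If the bottom entry $i_{l+1}$ exceeded the top entry of its column, then more than [c] bottom
   entries, hence more than [c] top entries, would exceed $i_l$; the top entry would then be at
   least $i_{l+1}$. *)
- move=> c ck; rewrite leqNgt; apply/negP => lt1.
  have cB' : (c < size (row_of b))%N by rewrite sB.
  have cA' : (c < size (row_of a))%N by rewrite sA; lia.
  have /(mem_flag_dim (t := t))[[//|l] /= lt ex] := row_of_sub (mem_nth 0%N cB').
  have : (fd l < nth 0%N (row_of b) c)%N.
    by rewrite /= in ex; rewrite ex; apply: (flag_dim_lt vt); rewrite ltnSn.
  rewrite (desc_count _ (row_of_desc b) cB').
  have [eA eB] := tableau_of_count (ltnW lt); rewrite -/(bottom_count tableau_of l) eB.
  move=> cb; have : (c < top_count tableau_of l)%N.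
    by rewrite eA; apply: leq_trans cb _; apply: ba; exact: ltnW.
  rewrite /top_count -(desc_count _ (row_of_desc a) cA').
  have := dim_succ_cmp lt (row_of_sub (mem_nth 0%N cA')).
  move: lt1; rewrite /= ex => lt1.
  have -> : (fd l.+1 < nth 0%N (row_of a) c)%N = false by lia.
  by rewrite (ltn_eqF lt1); case: (fd l < _)%N.
Qed.

End FromShapes.

(** * The shapes occurring in the refined tableau *)

Section Phi.
Variable S : tableau.
Hypothesis stS : standard_tableau n k t S.

Definition phi_top i := count (fun x => i < x)%N (phi t S).1.
Definition phi_bottom i := count (fun x => i < x)%N (phi t S).2.

Lemma double_dim l : (l < size t)%N ->
  double_entry t (fd l.+1) = (fd l.+1 == (fd l).+2).
Proof.
move=> lt; rewrite /double_entry tmult_dim //.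
have : (fd l < fd l.+1)%N by apply: (flag_dim_lt vt); rewrite ltnSn.
by move=> ?; apply/eqP/eqP; lia.
Qed.

Lemma phi_top_dim l : phi_top (fd l) = top_count S l.
Proof. by []. Qed.

(** A lowered double entry lands strictly between two consecutive dimensions of the type, so
    comparisons with these dimensions do not change. *)
Lemma phi_bottom_dim l : (l <= size t)%N -> phi_bottom (fd l) = bottom_count S l.
Proof.
move=> lt; rewrite /phi_bottom /bottom_count count_map; apply: eq_in_count => x xS /=.
have [_ sub] := standard_sub stS.
have /(mem_flag_dim (t := t))[[//|l'] /= l't ->] := sub x xS.
rewrite double_dim //; case: eqP => // eq2.
have [h|h] := leqP l l'.
  have : (fd l <= fd l')%N by apply: (flag_dim_le vt); rewrite h ltnW.
  by rewrite eq2; lia.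
have : (fd l'.+1 <= fd l)%N by apply: (flag_dim_le vt); rewrite h.
by lia.
Qed.

(** At the dimension inside a double step the lowered bottom entry has been passed and the top entry
    has not: the refinement removes the bottom box first. *)
Lemma phi_double l : (l < size t)%N -> fd l.+1 = (fd l).+2 ->
  phi_top (fd l).+1 = top_count S l /\ phi_bottom (fd l).+1 = bottom_count S l.+1.
Proof.
move=> lt eq2; have [sub1 sub2] := standard_sub stS.
split.
  apply: eq_in_count => x /sub1 xt.
  have /(mem_flag_dim (t := t))[[//|l'] /= l't ->] := xt.
  have [h|h] := leqP l l'.
    have : (fd l.+1 <= fd l'.+1)%N by apply: (flag_dim_le vt); rewrite ltnS h.
    by lia.
  have : (fd l'.+1 <= fd l)%N by apply: (flag_dim_le vt); rewrite h ltnW.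
  by lia.
rewrite /phi_bottom /bottom_count count_map; apply: eq_in_count => x /sub2 xt /=.
have /(mem_flag_dim (t := t))[[//|l'] /= l't ->] := xt.
rewrite double_dim //.
have [h|h|<-] := ltngtP l l'; last by rewrite eq2 eqxx /= !ltnn.
  have : (fd l.+1 <= fd l')%N by apply: (flag_dim_le vt); rewrite h ltnW.
  have : (fd l' < fd l'.+1)%N by apply: (flag_dim_lt vt); rewrite ltnSn.
  by case: eqP; lia.
have : (fd l'.+1 <= fd l)%N by apply: (flag_dim_le vt); rewrite h ltnW.
by case: eqP; lia.
Qed.

Lemma dim_cases i : (i <= n)%N ->
  (exists2 l, (l <= size t)%N & i = fd l) \/
  (exists l, [/\ (l < size t)%N, fd l.+1 = (fd l).+2 & i = (fd l).+1]).
Proof.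
move=> iN.
suff H m : (m <= size t)%N -> (i <= fd m)%N ->
  (exists2 l, (l <= size t)%N & i = fd l) \/
  (exists l, [/\ (l < size t)%N, fd l.+1 = (fd l).+2 & i = (fd l).+1]).
  by apply: (H _ (leqnn _)); rewrite (flag_dim_last vt).
elim: m => [|m IH] mt.
  by rewrite /flag_dim /= leqn0 => /eqP->; left; exists 0%N.
move=> im; have [|mi] := leqP i (fd m); first exact: IH (ltnW mt).
have := standard_gap stS mt; have [->|ne] := eqVneq i (fd m.+1).
  by left; exists m.+1.
by move=> gap; right; exists m; split=> //; lia.
Qed.

Lemma phi_le i : (i <= n)%N -> (phi_bottom i <= phi_top i)%N.
Proof.
case/dim_cases => [[l lt ->]|[l [lt eq2 ->]]].
  by rewrite phi_top_dim phi_bottom_dim //; exact: standard_le stS l.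
have [-> ->] := phi_double lt eq2; apply: leq_trans (standard_le stS l.+1) _.
by apply: sub_count => x /=; have := flag_dim_lt vt (_ : (l < l.+1 <= size t)%N); rewrite ltnSn lt => /(_ isT); lia.
Qed.

End Phi.

End Tableaux.

(** * Forgetting subspaces *)

Section Forget.
Variables (n' k : nat) (t : seq nat).
Local Notation n := n'.+1.
Local Notation N := (Nmx n k).
Local Notation fd := (flag_dim t).
Local Notation tf := (full_type n).
Hypothesis kn : (2 * k <= n)%N.
Hypothesis vt : valid_type n t.
Implicit Types (F P : seq 'M[C]_n) (g : 'M[C]_n) (Z : seq 'M[C]_n -> Prop).

Lemma full_dim i : (i <= n)%N -> flag_dim tf i = i.
Proof. by case: i => // i lt; rewrite /flag_dim -[LHS]/(nth 0%N (iota 1 n) i) nth_iota. Qed.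

Lemma valid_full : valid_type n tf.
Proof.
split; first by [].
split; first exact: (iota_ltn_sorted 0 n.+1).
by rewrite -nth_last size_iota nth_iota.
Qed.

Lemma size_full : size tf = n.
Proof. exact: size_iota. Qed.

Lemma fd_gt0 l : (0 < l <= size t)%N -> (0 < fd l)%N.
Proof. by move=> h; apply: (flag_dim_lt vt (l := 0%N)). Qed.

Lemma fd_le l : (l <= size t)%N -> (fd l <= n)%N.
Proof. exact: (flag_dim_max vt). Qed.

Lemma pr_prev F l : (l <= size t)%N -> flag_prev (pr t F) l = flag_prev F (fd l).
Proof.
case: l => // l lt; rewrite /= /pr (nth_map 0%N) //.
by have := fd_gt0 (l := l.+1) lt; rewrite /flag_dim /=; case: (nth 0%N t l).
Qed.

Lemma full_rank F i : is_flag tf F -> (i <= n)%N -> \rank (flag_prev F i) = i.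
Proof. by move=> fF lt; rewrite (flag_rank fF) ?size_full // full_dim. Qed.

Lemma full_sub F i j : is_flag tf F -> (i <= j <= n)%N ->
  (flag_prev F i <= flag_prev F j)%MS.
Proof. by move=> fF h; apply: (flag_sub fF); rewrite size_full. Qed.

Lemma pr_flag F : is_flag tf F -> is_flag t (pr t F).
Proof.
move=> fF; split; first by rewrite size_map.
split=> l lt.
  change (<<flag_prev (pr t F) l.+1>>%MS = flag_prev (pr t F) l.+1 /\
    \rank (flag_prev (pr t F) l.+1) = fd l.+1).
  rewrite pr_prev // full_rank ?fd_le //; split=> //.
  by apply: (flag_genmx fF); rewrite size_full fd_le.
change (flag_prev (pr t F) l.+1 <= flag_prev (pr t F) l.+2)%MS.
rewrite !pr_prev // 1?ltnW //; apply: full_sub => //.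
by rewrite fd_le // andbT; apply: (flag_dim_le vt); rewrite leqnSn.
Qed.

Lemma full_flag_of_prev g i : (i <= n)%N ->
  flag_prev (flag_of tf g) i = <<(pid_mx i : 'M[C]_n) *m g>>%MS.
Proof. by move=> lt; rewrite flag_of_prev ?size_full // full_dim. Qed.

Lemma pr_flag_of g : pr t (flag_of tf g) = flag_of t g.
Proof.
apply: (@flag_ext _ t); rewrite ?size_map // => l lt.
by rewrite pr_prev // full_flag_of_prev ?fd_le // flag_of_prev.
Qed.

(** For $i_l \le i < i_{l+1}$ one has $N F_{i+1} \subseteq N F_{i_{l+1}} \subseteq F_{i_l} \subseteq
    F_i$. *)
Lemma refine_Sp P F : Sp k t P -> (forall l, (l < size t)%N -> (fd l.+1 <= (fd l).+2)%N) ->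
  is_flag tf F -> pr t F = P -> Sp k tf F.
Proof.
move=> sP gap fF eP; split=> // i; rewrite size_full => lt.
change (flag_prev F i.+1 *m N <= flag_prev F i)%MS.
have [l [lt1 il li]] : exists l, [/\ (l < size t)%N, (fd l <= i)%N & (i < fd l.+1)%N].
  suff H m : (m <= size t)%N -> (i < fd m)%N ->
      exists l, [/\ (l < size t)%N, (fd l <= i)%N & (i < fd l.+1)%N].
    by apply: (H _ (leqnn _)); rewrite (flag_dim_last vt).
  elim: m => [|m IH] mt; first by rewrite /flag_dim.
  move=> im; have [mi|mi] := leqP (fd m) i; first by exists m.
  exact: IH (ltnW mt) mi.
have := Sp_step sP lt1; rewrite -eP !pr_prev // 1?ltnW // => stp.
apply: submx_trans (submx_trans (submxMr _ _) stp) _.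
  by apply: full_sub; rewrite // li fd_le.
by apply: full_sub; rewrite // il ltnW.
Qed.

(** The refinements of the flag of [g] are the full flags of [u *m g], with [u] in the parabolic
    subgroup. For fixed [u] the equations of [Z] at [u *m g] are polynomial in [g]; they are imposed
    for all [u] at once. *)
Lemma zclosed_refine Z : zclosed tf Z ->
  zclosed t (fun P => is_flag t P /\ forall F, is_flag tf F -> pr t F = P -> Z F).
Proof.
move=> [Zf [S [pS hS]]].
pose I := {fu : ('M[C]_n -> C) * 'M[C]_n |
   [/\ S fu.1, fu.2 \in unitmx & forall g, flag_of t (fu.2 *m g) = flag_of t g]}.
apply: (@zclosedI _ t I (fun i g => (sval i).1 ((sval i).2 *m g))).
- by move=> F [].
- move=> [[f u] /= [Sf _ _]]; apply: polyfun_polymx; first exact: pS.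
  by apply: polymx_mul; [exact: polymx_cst|exact: polymx_id].
- move=> g ug; split.
    move=> [_ h] [[f u] /= [Sf uu hu]].
    have uug : u *m g \in unitmx by rewrite unitmx_mul uu.
    have Zu : Z (flag_of tf (u *m g)).
      by apply: h (flag_of_flag valid_full uug) _; rewrite pr_flag_of hu.
    by have /(hS _ uug) := Zu; apply.
  move=> h; split; first exact: (flag_of_flag vt).
  move=> F fF eF; have [g' ug' eF'] := flag_of_surj valid_full fF.
  rewrite eF'; apply/(hS _ ug') => f Sf.
  rewrite eF' pr_flag_of in eF.
  have hu : [/\ S (f, g' *m invmx g).1, (f, g' *m invmx g).2 \in unitmx &
       forall g1, flag_of t ((f, g' *m invmx g).2 *m g1) = flag_of t g1].
    split=> //=; first by rewrite unitmx_mul unitmx_inv ug' ug.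
    by move=> g1; exact: flag_of_mul_eq.
  by have := h (exist _ _ hu); rewrite /= mulmxKV.
Qed.

(** * The Springer cell and its image under the forgetful map *)

Section PhiCell.
Variable S : tableau.
Hypothesis stS : standard_tableau n k t S.
Local Notation A := (phi_top t S).
Local Notation B := (phi_bottom t S).
Local Notation a := (top_count t S).
Local Notation b := (bottom_count t S).

Lemma springer_cellE F : springer_cell k (phi t S) F <-> cell k tf A B F.
Proof.
have prevE i : full_flag_at F i = flag_prev F i by case: i.
split=> [[sF rk]|[sF fr]].
  have [a1 [b1 [_ _ [_ fr1] le1 _]]] := Sp_frames kn valid_full sF.
  split=> // i; rewrite size_full => lt.
  have [e [y fr]] : exists e y, frame N (flag_prev F i) (a1 i) (b1 i) e y.
    by apply: fr1; rewrite size_full.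
  have le : (b1 i <= a1 i)%N by apply: le1; rewrite size_full.
  have rki j : ((a1 i - j) + (b1 i - j) = (A i - j) + (B i - j))%N.
    have := rk i lt j; rewrite /= prevE (rank_powers j fr) -/(A i) -/(B i).
    by rewrite full_rank //; [move/addnI|case: sF].
  (* Exponent 0 compares the sums of the parts, and the exponents [a1 i] and [A i] compare the
     larger parts. *)
  have := phi_le kn vt stS lt; have := rki 0%N; have := rki (a1 i); have := rki (A i).
  move=> h1 h2 h3 h4; have [<- <-] : a1 i = A i /\ b1 i = B i by lia.
  by exists e, y.
split=> // i lt A' B' j.
have [|e [y fri]] := fr i; first by rewrite size_full.
have fF : is_flag tf F by case: sF.
by have := rank_powers j fri; rewrite full_rank // -prevE.
Qed.

Lemma double_step l : (l < size t)%N -> fd l.+1 = (fd l).+2 ->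
  a l = (a l.+1).+1 /\ b l = (b l.+1).+1.
Proof.
move=> lt eq2; have := standard_dim kn vt stS lt; have := standard_dim kn vt stS (ltnW lt).
by case: (standard_step kn vt stS lt) => *; lia.
Qed.

Lemma phi_leq i : (i <= size tf)%N -> (B i <= A i)%N.
Proof. by rewrite size_full; exact: (phi_le kn vt stS). Qed.

(** The delicate point is invariance across a double step, where dimensions jump by two. In the
    refined tableau it is a bottom step followed by its matching top step, so the arc relation holds
    with exponent one. *)
Lemma pr_cell F : cell k tf A B F -> cell k t a b (pr t F).
Proof.
move=> cF; have [sF fr] := cF; have fF : is_flag tf F by case: sF.
split; last first.
  move=> l lt; have [|e [y frl]] := fr (fd l); first by rewrite size_full fd_le.
  by exists e, y; rewrite pr_prev // -(phi_bottom_dim kn vt stS).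
split; first exact: pr_flag.
move=> l lt; change (flag_prev (pr t F) l.+1 *m N <= flag_prev (pr t F) l)%MS.
rewrite !pr_prev // 1?ltnW //.
have lt1 := fd_le lt.
have [eq1|eq2] : fd l.+1 = (fd l).+1 \/ fd l.+1 = (fd l).+2.
  have := standard_gap kn vt stS lt; have : (fd l < fd l.+1)%N by apply: (flag_dim_lt vt); rewrite ltnSn.
  by lia.
  by rewrite eq1 in lt1 *; apply: (Sp_step sF); rewrite size_full.
have [ea eb] := double_step lt eq2.
have [eA eB] := phi_double kn vt stS lt eq2.
have A0 : A (fd l) = a l by [].
have B0 := phi_bottom_dim kn vt stS (ltnW lt).
have A2 : A (fd l.+1) = a l.+1 by [].
have B2 := phi_bottom_dim kn vt stS lt.
have := @cell_arc n' k tf kn valid_full A B F phi_leq cF (fd l.+1) (fd l).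
have -> : (B (fd l) - B (fd l.+1) = 1)%N by lia.
rewrite expr1 => arc; apply: submx_trans (arc _ _) _.
- by rewrite size_full lt1 andbT eq2; lia.
- move=> i /andP[il li].
  have [->|ne] := eqVneq i (fd l); first by lia.
  have [->|ne2] := eqVneq i (fd l.+1); first by lia.
  have -> : i = (fd l).+1 by lia.
  by lia.
- rewrite addsmx_sub submx_refl andTb.
  apply: (cell_power_sub phi_leq cF); first by rewrite size_full; lia.
  by lia.
Qed.

End PhiCell.

Lemma addrBACA (V : zmodType) (x u v w : V) : x + w - u - (v + w) = x - u - v.
Proof. by rewrite [x + w - u]addrAC opprD addrACA subrr addr0. Qed.

(** * Density of generic refinements and the image of a Springer component *)

Section GenericRefinement.
Variable S : tableau.
Hypothesis stS : standard_tableau n k t S.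
Local Notation A := (phi_top t S).
Local Notation B := (phi_bottom t S).
Local Notation a := (top_count t S).
Local Notation b := (bottom_count t S).

(* Refining a flag of the cell inside a double step is choosing a line in a
   two-dimensional kernel; all choices but one have generic type. *)
Lemma double_generic F (i : 'I_n) (x : 'rV[C]_n) : cell k t a b (pr t F) ->
  is_flag tf F -> (x <= flag_prev F i.+1)%MS ->
  exists vc : 'rV[C]_n * C,
  (vc.1 = 0 /\ exists2 l, (l <= size t)%N & i.+1 = fd l) \/
  (exists l, [/\ (l < size t)%N, fd l.+1 = (fd l).+2, i = fd l :> nat,
     (vc.1 <= flag_prev F i.+2)%MS &
     forall s, s != vc.2 -> exists e y,
       frame N (flag_prev F i + (x + s *: vc.1)%R)%MS (A i.+1) (B i.+1) e y]).
Proof.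
move=> cP fF xF.
have [[l lt el]|[l [lt eq2 [ei]]]] := dim_cases kn vt stS (ltn_ord i).
  by exists (0, 0); left; split=> //; exists l.
have [ea eb] := double_step stS lt eq2.
have [sP _] := cP.
have ba l' (_ : (l' <= size t)%N) : (b l' <= a l')%N by exact: (standard_le kn stS).
have [_ [e [y [frl _ eqW]]]] := cell_step kn vt ba cP lt.
rewrite (pr_prev F (ltnW lt)) (pr_prev F lt) eq2 -ei in frl eqW.
rewrite ea eb in frl.
have lt2 : (i.+2 <= n)%N by rewrite ei -eq2 fd_le.
have stp : (flag_prev F i.+2 *m N <= flag_prev F i)%MS.
  by have := Sp_step sP lt; rewrite !pr_prev // 1?ltnW // eq2 -ei.
have xN : (x *m N <= flag_prev F i)%MS.
  apply: submx_trans (submxMr _ (submx_trans xF _)) stp.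
  by apply: full_sub; rewrite // leqnSn.
have [c [d /= xcd]] := frame_kernel frl xN.
exists (y *m N ^+ b l.+1, - d); right; exists l; split=> //=.
  rewrite eqW (_ : (b l == b l.+1) = false) ?addsmxSr //.
  by rewrite eb gtn_eqF.
move=> s sd; have dz : d + s != 0 by rewrite addrC addr_eq0.
have [eA eB] := phi_double kn vt stS lt eq2; rewrite ei eA eB -ei ea.
have ba1 : ((b l.+1).+1 <= (a l.+1).+1)%N by exact: (standard_le kn stS l.+1).
have xcs : (x + s *: (y *m N ^+ b l.+1) - c *: (e *m N ^+ a l.+1)
    - (d + s) *: (y *m N ^+ b l.+1) <= flag_prev F i)%MS.
  by rewrite scalerDl addrBACA.
have [y' [fr' eqU]] := frame_generic_row ba1 frl dz xcs.
by exists e, y'; apply: (frame_eqmx (eqmx_sym eqU)); exact: frame_dropr.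
Qed.

(** [F] is deformed along a line of matrices inside the fibre of [pr]. For all but finitely many
    parameters the refinement lies in the cell of the refined tableau, hence in [Z]; the equations
    of [Z] then hold at parameter 0 too. *)
Lemma refine_closed F Z : zclosed tf Z -> subset_of (cell k tf A B) Z ->
  cell k t a b (pr t F) -> is_flag tf F -> Z F.
Proof.
move=> cZ AZ cP fF; have [sP fr] := cP; have fP : is_flag t (pr t F) by case: sP.
have [g ug eF] := flag_of_surj valid_full fF.
have rowF i : (row i g <= flag_prev F (i : 'I_n).+1)%MS.
  by rewrite eF full_flag_of_prev // genmxE; exact: row_sub_pid.
(* [vc i] gives the direction in which row [i] moves, zero outside the middle of a double step, and
   the excluded parameter. *)
have [vc hvc] := fin_all_exists (fun i => double_generic cP fF (rowF i)).
pose h : 'M[C]_n := \matrix_i (vc i).1.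
pose G := map_mx polyC g + 'X *: map_mx polyC h.
have cG s : curve_at G s = g + s *: h.
  apply/matrixP => r c; rewrite !mxE.
  change (((g r c)%:P + 'X * ((vc r).1 0 c)%:P : {poly C}).[s] = g r c + s * (vc r).1 0 c).
  by rewrite hornerD hornerM hornerX !hornerC.
have keep s l : (l <= size t)%N -> curve_at G s \in unitmx ->
    <<(pid_mx (fd l) : 'M[C]_n) *m curve_at G s>>%MS = flag_prev F (fd l).
  move=> lt us; have fdn := fd_le lt.
  have sub : ((pid_mx (fd l) : 'M[C]_n) *m curve_at G s <= flag_prev F (fd l))%MS.
    apply/pid_mul_subP => i il; rewrite cG linearD linearZ /= rowK.
    apply: addmx_sub.
      by apply: submx_trans (rowF i) _; apply: full_sub; rewrite // il.
    apply: scalemx_sub; case: (hvc i) => [[-> _]|[l' [lt' eq2 ei vF _]]].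
      exact: sub0mx.
    apply: submx_trans vF _; apply: full_sub => //; rewrite fdn andbT ei -eq2.
    apply: (flag_dim_le vt); rewrite lt andbT ltnNge; apply/negP => ll'.
    have : (fd l <= fd l')%N by apply: (flag_dim_le vt); rewrite ll' ltnW.
    by rewrite -ei leqNgt il.
  rewrite -(flag_genmx fF (l := fd l)) ?size_full //; apply/genmxP.
  by rewrite -(mxrank_leqif_eq sub) rank_pid_mul // full_rank.
have inZ s : curve_at G s \in unitmx -> (forall i, s != (vc i).2) ->
    Z (flag_of tf (curve_at G s)).
  move=> us sc; apply: AZ; set F' := flag_of tf _.
  have fF' : is_flag tf F' by exact: (flag_of_flag valid_full).
  have prF' : pr t F' = pr t F.
    apply: (@flag_ext _ t); rewrite ?size_map // => l lt.
    by rewrite !pr_prev // full_flag_of_prev ?fd_le // keep.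
  split; first exact: (refine_Sp sP (fun l => standard_gap kn vt stS (l := l)) fF' prF').
  move=> i; rewrite size_full => iN.
  have [[l lt ->]|[l [lt eq2 ei]]] := dim_cases kn vt stS iN.
    have [e [y frl]] := fr l lt; exists e, y.
    by rewrite (phi_bottom_dim kn vt stS lt) -(pr_prev F' lt) prF'.
  have ltn' : (fd l < n)%N by rewrite -ei.
  pose j := Ordinal ltn'; rewrite ei full_flag_of_prev //.
  case: (hvc j) => [[_ [l1 lt1 ej]]|[l' [_ _ _ _ gen]]].
    exfalso; have [h1|h1] := leqP l1 l.
      have : (fd l1 <= fd l)%N by apply: (flag_dim_le vt); rewrite h1 ltnW.
      by rewrite -ej /= ltnn.
    have : (fd l.+1 <= fd l1)%N by apply: (flag_dim_le vt); rewrite h1.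
    by rewrite -ej eq2 /= ltnn.
  have [e [y frj]] := gen s (sc j); exists e, y; apply: frame_eqmx frj.
  apply: eqmx_trans (eqmx_sym (genmxE _)); apply: eqmx_sym.
  apply: eqmx_trans (pid_mulS (curve_at G s) j) _.
  have -> : row j (curve_at G s) = row j g + s *: (vc j).1.
    by rewrite cG linearD linearZ /= rowK.
  apply: adds_eqmx => //; apply: eqmx_trans (eqmx_sym (genmxE _)) _.
  by rewrite keep // ltnW.
have [_ [S0 [pS0 hS0]]] := cZ.
rewrite eF; apply/(hS0 _ ug) => f Sf; apply/eqP/negPn/negP => nz.
have [q hq] := polyfun_curve G (pS0 _ Sf).
have G0 : curve_at G 0 = g by rewrite cG scale0r addr0.
(* A non-root of this product avoids singular matrices, the zeros of [f] on the line and all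
   excluded parameters. *)
have : \det G * (q * \prod_i ('X - (vc i).2%:P)) != 0.
  rewrite !mulf_neq0 //.
  - apply/eqP => d0; move: ug; rewrite unitmxE unitfE -G0 det_curve d0.
    by rewrite horner0 eqxx.
  - apply/eqP => q0; case/eqP: nz; have := hq 0; rewrite q0 horner0 => <-.
    by rewrite -/(curve_at G 0) G0.
  - by apply/prodf_neq0 => i _; rewrite polyXsubC_eq0.
case/closed_nonrootP => s; rewrite /root !hornerM !mulf_eq0 !negb_or.
move=> /and3P[ds qs ps].
have us : curve_at G s \in unitmx by rewrite unitmxE unitfE det_curve.
have sc i : s != (vc i).2.
  apply: contra ps => /eqP ->; rewrite horner_prod (bigD1 i) //= !hornerE subrr.
  by rewrite mul0r.
have /(hS0 _ us)/(_ f Sf)/eqP := inZ s us sc.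
by rewrite [f _]hq (negPf qs).
Qed.

(* The refinements of a point of the closure stay in the closure, because all
   refinements of flags of the cell do. *)
Lemma pr_imageE : seteq (@pr_image n k t (phi t S)) (zclosure t (cell k t a b)).
Proof.
have cellf P : cell k t a b P -> is_flag t P by case=> [[]].
have scf F : springer_cell k (phi t S) F -> is_flag tf F by case=> [[]].
move=> P; split.
  move=> [F [[fF cF] ->]]; split; first exact: pr_flag.
  move=> Z cZ AZ.
  have [g ug eF] := flag_of_surj valid_full fF.
  (* The preimage of [Z] under [pr] is closed: it has the same equations in $GL_n$, since [pr] sends
     the full flag of a matrix to its flag of type [t]. *)
  have [] // := cF (fun F => is_flag tf F /\ Z (pr t F)).
    have [_ [S0 [pS0 hS0]]] := cZ; split=> [G []//|]; exists S0; split=> // g1 ug1.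
    rewrite pr_flag_of -(hS0 _ ug1); split=> [[]//|h]; split=> //.
    exact: (flag_of_flag valid_full).
  move=> G cG; split; first exact: scf.
  by apply: AZ; apply: (pr_cell stS); apply/(springer_cellE stS).
move=> [fP cP]; have [g ug eP] := flag_of_surj vt fP.
exists (flag_of tf g); split; last by rewrite pr_flag_of.
have fF := flag_of_flag valid_full ug.
split=> // Z cZ AZ.
have [_ h] : is_flag t P /\ forall F, is_flag tf F -> pr t F = P -> Z F.
  apply: cP (zclosed_refine cZ) _ => Q cQ; split; first exact: cellf.
  move=> F fF' eQ; apply: refine_closed fF' => //.
    by move=> G cG; apply: AZ; apply/(springer_cellE stS).
  by rewrite eQ.
by apply: h; rewrite // pr_flag_of.
Qed.

End GenericRefinement.

(** * Irreducible components as closures of cells *)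

Lemma standard_cell_nonempty S : standard_tableau n k t S ->
  exists P : seq 'M[C]_n, cell k t (top_count t S) (bottom_count t S) P.
Proof.
move=> stS; apply: (cell_exists kn).
- exact: (standard_top0 vt stS).
- exact: (standard_bottom0 vt stS).
- by move=> l lt; exact: (standard_dim kn vt stS lt).
- by move=> l lt; exact: (standard_step kn vt stS lt).
Qed.

Lemma Sp_standard P : Sp k t P -> exists S, standard_tableau n k t S /\
  cell k t (top_count t S) (bottom_count t S) P.
Proof.
move=> sP; have [a [b [a0 b0 cP ba step]]] := Sp_frames kn vt sP.
have dims l (lt : (l <= size t)%N) := cell_rank cP lt.
exists (tableau_of t a b); split; first exact: tableau_of_standard.
have [_ fr] := cP; split=> // l lt.
have [-> ->] := tableau_of_count kn vt a0 b0 dims step lt.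
exact: fr.
Qed.

Lemma closure_sub_eq S S' : standard_tableau n k t S -> standard_tableau n k t S' ->
  subset_of (@zclosure n t (cell k t (top_count t S) (bottom_count t S)))
            (zclosure t (cell k t (top_count t S') (bottom_count t S'))) ->
  S = S'.
Proof.
move=> stS stS' sub; apply: (standard_inj kn vt stS stS').
have [P cP] := standard_cell_nonempty stS.
have [P' cP'] := standard_cell_nonempty stS'.
have cellf T (Q : seq 'M[C]_n) :
    cell k t (top_count t T) (bottom_count t T) Q -> is_flag t Q by case=> [[]].
apply: (cell_sub_eq kn vt _ _ _ cP cP').
- by move=> l _; exact: (standard_le kn stS).
- by move=> l _; exact: (standard_le kn stS').
- by move=> Q cQ; apply: sub; exact: (zclosure_sub (@cellf S)).
- exact: (standard_top0 vt stS).
- exact: (standard_top0 vt stS').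
- exact: (standard_bottom0 vt stS').
Qed.

Lemma standard_closure_irreducible S : standard_tableau n k t S ->
  irreducible t (@zclosure n t (cell k t (top_count t S) (bottom_count t S))).
Proof.
move=> stS; apply: irreducible_zclosure; apply: (cell_irreducible kn vt).
  by move=> l _; exact: (standard_le kn stS).
exact: standard_cell_nonempty.
Qed.

Lemma irreducible_sub_closure Z : irreducible t Z -> subset_of Z (Sp k t) ->
  exists S, standard_tableau n k t S /\
    subset_of Z (zclosure t (cell k t (top_count t S) (bottom_count t S))).
Proof.
move=> irrZ ZSp; have [s hs] := standard_finite k vt.
(* The finite list may contain pairs that are not standard; for those [Cl] is the closure of the
   empty set, which is empty and cannot contain [Z]. *)
pose Cl S := @zclosure n t (fun P => standard_tableau n k t S /\
   cell k t (top_count t S) (bottom_count t S) P).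
have clf S (P : seq 'M[C]_n) : standard_tableau n k t S /\
   cell k t (top_count t S) (bottom_count t S) P -> is_flag t P by case=> _ [[]].
have [S Ss ZS] : exists2 S, S \in s & subset_of Z (Cl S).
  apply: (irreducible_cover irrZ) => [S Ss|F ZF].
    by apply: (zclosed_zclosure vt); exact: clf.
  have [S [stS cS]] := Sp_standard (ZSp F ZF); exists S; first exact: hs.
  by apply: zclosure_sub => //; exact: clf.
have [stS|nst] := classic (standard_tableau n k t S).
  exists S; split=> // F ZF; have [fF h] := ZS F ZF; split=> // W cW sub.
  by apply: h => // P [_]; exact: sub.
have [[F ZF] _] := irrZ; have [_ h] := ZS F ZF.
by have [] := h _ (zclosed_empty n t) (fun P hP => nst (proj1 hP)).
Qed.

Lemma irr_component_ext Z Z' : seteq Z Z' ->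
  irr_component t (Sp k t) Z' -> irr_component t (Sp k t) Z.
Proof.
move=> eqZ [[[F ZF] [Zf irr]] [ZX maxZ]].
have to P : Z P -> Z' P by move/eqZ.
have from P : Z' P -> Z P by move/eqZ.
split; first split; first by exists F; exact: from.
  split; first by move=> P /to/Zf.
  move=> C1 C2 c1 c2 cov; have [|h|h] := irr C1 C2 c1 c2.
  - by move=> P /from/cov.
  - by left=> P /to/h.
  - by right=> P /to/h.
split; first by move=> P /to/ZX.
by move=> W irrW ZW WX P WP; apply/from/(maxZ W irrW) => // Q /from/ZW.
Qed.

(** A larger irreducible subset lies in the closure of some cell, and an inclusion between closures
    of cells forces the tableaux to coincide. *)
Lemma standard_closure_component S : standard_tableau n k t S ->
  irr_component t (Sp k t) (@zclosure n t (cell k t (top_count t S) (bottom_count t S))).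
Proof.
move=> stS; split; first exact: standard_closure_irreducible.
split; first by move=> F; exact: zclosure_Sp.
move=> Z irrZ sub ZSp.
have [S' [stS' ZS']] := irreducible_sub_closure irrZ ZSp.
have eS : S = S' by apply: closure_sub_eq => // F /sub/ZS'.
by rewrite eS.
Qed.

End Forget.

Theorem theorem4p3 (n k : nat) (t : seq nat) :
  (2 * k <= n)%N -> valid_type n t ->
  (* S |-> pr(Y_phi(S)) maps standard tableaux into the irreducible
     components of Sp(t) *)
  (forall S, standard_tableau n k t S ->
     @irr_component n t (@Sp n k t) (@pr_image n k t (phi t S))) /\
  (* injective *)
  (forall S S', standard_tableau n k t S -> standard_tableau n k t S' ->
     seteq (@pr_image n k t (phi t S)) (@pr_image n k t (phi t S')) -> S = S') /\
  (* surjective *)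
  (forall Z, @irr_component n t (@Sp n k t) Z ->
     exists S, standard_tableau n k t S /\
       seteq (@pr_image n k t (phi t S)) Z).
Proof.
move=> kn vt; case: n kn vt => [|n'] kn vt.
  (* [n = 0] is impossible, because a valid type is nonempty with positive last entry. *)
  have := flag_dim_lt vt (_ : (0 < size t <= size t)%N).
  by rewrite leqnn (type_gt0 vt) (flag_dim_last vt) => /(_ isT).
split; last split.
- move=> S stS; apply: irr_component_ext (pr_imageE kn vt stS) _.
  exact: standard_closure_component.
- move=> S S' stS stS' eqS; apply: (closure_sub_eq kn vt) => // P.
  by move/(pr_imageE kn vt stS)/eqS/(pr_imageE kn vt stS').
- move=> Z [irrZ [ZX maxZ]].
  have [S [stS ZS]] := irreducible_sub_closure kn vt irrZ ZX.
  exists S; split=> // P; split; last by move/ZS/(pr_imageE kn vt stS).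
  move/(pr_imageE kn vt stS); apply: maxZ => //.
    exact: standard_closure_irreducible.
  by move=> F; exact: zclosure_Sp.
Qed.
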